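(* Let $G$ be a countable infinite residually finite (discrete) group and let $\overleftarrow{G}$ be a totally disconnected metric compactification of $G$. Then there exists an irregular Toeplitz array $\eta\in\{0,1\}^G$ such that the maximal equicontinuous factor of $(\overline{O_\sigma(\eta)},\sigma,G)$ is $\overleftarrow{G}$, and $\overline{O_\sigma(\eta)}$ is a topo-isomorphic extension of $\overleftarrow{G}$.
   Context: A totally disconnected metric compactification of $G$ is a totally disconnected compact metrizable group $\overleftarrow{G}$ for which there is an injective homomorphism $\iota:G\to\overleftarrow{G}$ with dense image; $G$ acts on $\overleftarrow{G}$ by $\phi^g(y)=\iota(g)y$. This system is minimal, equicontinuous and uniquely ergodic, its unique invariant probability measure being the Haar measure $\nu$. A dynamical system $(X,\sigma,G)$ is a continuous left action of $G$ on a compact metric space $X$. On $\{0,1\}^G$ (product topology) $G$ acts by the shift $\sigma^g x(h)=x(g^{-1}h)$; $O_\sigma(x)=\{\sigma^g x:g\in G\}$. For $x\in\{0,1\}^G$, a finite index subgroup $\Gamma\le G$ and $\alpha\in\{0,1\}$, $\mathrm{Per}(x,\Gamma,\alpha)=\{g\in G: x(\gamma g)=\alpha\ \forall\gamma\in\Gamma\}$ and $\mathrm{Per}(x,\Gamma)=\bigcup_\alpha \mathrm{Per}(x,\Gamma,\alpha)$. An element $\eta$ is a Toeplitz array if for each $g\in G$ there is a finite index subgroup $\Gamma$ with $g\in\mathrm{Per}(\eta,\Gamma)$. A factor map $\pi:X\to Y$ between systems is a continuous surjective $G$-equivariant map. The maximal equicontinuous factor of $X$ is an equicontinuous system $Y$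 with a factor map $\pi:X\to Y$ through which every factor map from $X$ to an equicontinuous system factors. Regularity: suppose the maximal equicontinuous factor of $\overline{O_\sigma(\eta)}$ is $\overleftarrow{G}$, with factor map $\pi$, and let $\mathcal{T}$ be the set of Toeplitz arrays in $\overline{O_\sigma(\eta)}$. The Toeplitz array $\eta$ is regular if $\nu(\pi(\mathcal{T}))=1$, and irregular otherwise. Topo-isomorphic extension: an invariant measure is a $G$-invariant Borel probability measure. Given a factor map $h:X\to Y$ and an invariant measure $\mu$ on $X$, $h$ is a measure conjugacy of $\mu$ if, with $\nu=h(\mu)$ the pushforward, there are invariant conull Borel sets $X'\subseteq X$ and $Y'\subseteq Y$ such that $h|_{X'}:X'\to Y'$ is a bimeasurable bijection. $X$ is a topo-isomorphic extension of $Y$ if there is a factor map $h:X\to Y$ that is a measure conjugacy of $\mu$ for every invariant measure $\mu$ of $X$. *)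

(* Defs.v *)
From HB Require Import structures.
From mathcomp Require Import all_boot all_order all_algebra.
From mathcomp Require Import all_classical all_reals all_analysis.

Set Implicit Arguments.
Unset Strict Implicit.
Unset Printing Implicit Defensive.

Local Open Scope classical_set_scope.
Local Open Scope group_scope.

(* Base points are only required because [measurableType] and [equicontinuous]
   are set up over pointed types; no definition below refers to them. *)
#[short(type="pmetricType")]
HB.structure Definition PMetric (R : numDomainType) :=
  {X of Metric R X & Pointed X}.

HB.mixin Record isTopologicalGroup K of Group K & Topological K := {
  mulg_continuous : continuous (fun xy : K * K => xy.1 * xy.2);
  invg_continuous : continuous (fun x : K => x^-1)
}.

#[short(type="metricGroupType")]
HB.structure Definition MetricGroup (R : numDomainType) :=
  {K of Group K & Metric R K & Pointed K & isTopologicalGroup K}.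

Section Groups.
Variable G : groupType.

Definition is_subgroup (H : set G) :=
  [/\ H 1, forall x y, H x -> H y -> H (x * y) & forall x, H x -> H x^-1].

Definition finite_index_subgroup (H : set G) :=
  is_subgroup H /\ finite_set (range (fun g : G => [set h * g | h in H])).

Definition residually_finite :=
  forall g : G, g <> 1 -> exists2 H : set G, finite_index_subgroup H & ~ H g.

End Groups.

Section Systems.
Variable G : groupType.

(* G is discrete, so an action is continuous iff each translation is. *)
Definition continuous_action (X : topologicalType) (act : G -> X -> X) :=
  [/\ forall x, act 1 x = x,
      forall g h x, act (g * h) x = act g (act h x) &
      forall g, continuous (act g)].

Definition equicontinuous_system (R : realType) (X : pmetricType R)
    (act : G -> X -> X) :=
  [/\ compact [set: X], continuous_action act &
      equicontinuous [set: G] act].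

Definition factor_map (X Y : topologicalType)
    (actX : G -> X -> X) (actY : G -> Y -> Y) (pi : X -> Y) :=
  [/\ continuous pi, range pi = [set: Y] &
      forall g x, pi (actX g x) = actY g (pi x)].

Definition maximal_equicontinuous_factor (R : realType)
    (X : topologicalType) (Y : pmetricType R)
    (actX : G -> X -> X) (actY : G -> Y -> Y) (pi : X -> Y) :=
  [/\ equicontinuous_system actY, factor_map actX actY pi &
      forall (Z : pmetricType R) (actZ : G -> Z -> Z) (q : X -> Z),
        equicontinuous_system actZ -> factor_map actX actZ q ->
        exists2 p : Y -> Z, factor_map actY actZ p & q = p \o pi].

End Systems.

Definition borel (X : ptopologicalType) := g_sigma_algebraType (@open X).

Section Measures.
Variables (R : realType) (G : groupType).
Local Open Scope ereal_scope.

Definition invariant_measure (X : ptopologicalType) (act : G -> X -> X)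
    (mu : probability (borel X) R) :=
  forall g (A : set (borel X)), measurable A -> mu (act g @^-1` A) = mu A.

Definition invariant_set (X : Type) (act : G -> X -> X) (A : set X) :=
  forall g, act g @` A = A.

Definition measure_conjugacy (X Y : ptopologicalType)
    (actX : G -> X -> X) (actY : G -> Y -> Y) (h : X -> Y)
    (mu : probability (borel X) R) :=
  let nu := @pushforward _ _ (borel X) (borel Y) R mu h in
  exists (X' : set (borel X)) (Y' : set (borel Y)),
    [/\ [/\ measurable X', invariant_set actX X' & mu (~` X') = 0],
        [/\ measurable Y', invariant_set actY Y' & nu (~` Y') = 0],
        set_bij X' Y' h,
        measurable_fun X' (h : borel X -> borel Y) &
        forall A : set (borel X), measurable A -> A `<=` X' ->
          @measurable _ (borel Y) (h @` A)].

Definition topo_isomorphic_extension (X Y : ptopologicalType)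
    (actX : G -> X -> X) (actY : G -> Y -> Y) :=
  exists2 h : X -> Y, factor_map actX actY h &
    forall mu : probability (borel X) R,
      invariant_measure actX mu -> measure_conjugacy actX actY h mu.

(* Haar probability measure of a compact group *)
Definition haar_measure (K : metricGroupType R)
    (nu : probability (borel K) R) :=
  forall (a : K) (A : set (borel K)), measurable A ->
    nu ((fun y : K => (a * y)%g) @^-1` A) = nu A.

End Measures.

Section Compactification.
Variables (R : realType) (G : groupType) (K : metricGroupType R).

Definition td_metric_compactification (iota : {multiplicative G -> K}) :=
  [/\ compact [set: K], totally_disconnected [set: K],
      injective iota & dense (range iota)].

Definition translation (iota : {multiplicative G -> K}) (g : G) (y : K) : K :=
  iota g * y.

End Compactification.

Section Shift.
Variable G : groupType.

Definition array := {ptws G -> bool}.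

Definition array_shift (g : G) (x : array) : array := fun h => x (g^-1 * h).

Definition shift_orbit (x : array) : set array := range (array_shift ^~ x).

Definition orbit_closure (x : array) : set array := closure (shift_orbit x).

Definition Per_val (x : array) (H : set G) (alpha : bool) : set G :=
  [set g | forall h, H h -> x (h * g) = alpha].

Definition Per (x : array) (H : set G) : set G :=
  \bigcup_alpha Per_val x H alpha.

Definition toeplitz_array (x : array) :=
  forall g : G, exists2 H : set G, finite_index_subgroup H & Per x H g.

Lemma shift_continuous g : continuous (array_shift g).
Proof.
move=> x; apply/cvg_sup => i U [_ [[B oB <-] Bx] BU].
apply: filterS BU _.
have := @proj_continuous _ (fun _ : G => (bool : topologicalType)) (g^-1 * i) x.
by apply; apply: open_nbhs_nbhs; split.
Qed.

Lemma shiftM g h x : array_shift (g * h) x = array_shift g (array_shift h x).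
Proof. by apply/funext => k; rewrite /array_shift invgM mulgA. Qed.

Lemma orbit_closure_id x : orbit_closure x x.
Proof.
by apply: subset_closure; exists 1 => //; apply/funext => k;
  rewrite /array_shift invg1 mul1g.
Qed.

Lemma orbit_closure_shift x g y :
  orbit_closure x y -> orbit_closure x (array_shift g y).
Proof.
move=> xy B /shift_continuous /xy[_ [[h _ <-] Bh]].
by exists (array_shift (g * h) x); split; [exists (g * h) | rewrite shiftM].
Qed.

Definition orbit_closure_space (x : array) : Type := set_type (orbit_closure x).

Definition orbit_base (x : array) : orbit_closure_space x :=
  exist (fun y => y \in orbit_closure x) x (mem_set (@orbit_closure_id x)).

HB.instance Definition _ (x : array) :=
  Topological.copy (orbit_closure_space x) (set_type (orbit_closure x)).
HB.instance Definition _ (x : array) :=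
  isPointed.Build (orbit_closure_space x) (orbit_base x).

Definition sigma (x : array) (g : G) (y : orbit_closure_space x) :
    orbit_closure_space x :=
  exist (fun z => z \in orbit_closure x) (array_shift g (val y))
    (mem_set (@orbit_closure_shift x g (val y) (set_mem (valP y)))).

Definition toeplitz_points (x : array) : set (orbit_closure_space x) :=
  [set y | toeplitz_array (val y)].

End Shift.

Section Regularity.
Variables (R : realType) (G : groupType) (K : metricGroupType R).

(* The Haar measure nu is unique, hence can be introduced by a quantifier;
   likewise pi is unique up to a right translation of K, which preserves nu. *)
Definition regular_toeplitz (iota : {multiplicative G -> K}) (eta : array G) :=
  exists (pi : orbit_closure_space eta -> K) (nu : probability (borel K) R),
    [/\ maximal_equicontinuous_factor (@sigma G eta) (translation iota) pi,
        haar_measure nu & nu (pi @` @toeplitz_points G eta) = 1%E].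

Definition irregular_toeplitz (iota : {multiplicative G -> K})
    (eta : array G) :=
  toeplitz_array eta /\ ~ regular_toeplitz iota eta.

End Regularity.

(* Main.v *)
Require Import Defs.
From mathcomp Require Import all_boot all_order all_algebra.
From mathcomp Require Import all_classical all_reals all_analysis.
From mathcomp Require Import lra.

(* The array is [eta h = 1] iff [iota h] lies in [U1], where [U1] and [U0] are
   disjoint open subsets of [K] whose union contains [iota G] and whose common
   boundary [D], the complement of the union, has positive Haar measure. If
   [t U1] misses [U0] only for [t = 1], a point [x] of the orbit closure
   determines the [y] with [x h = i] whenever [y^-1 (iota h)] is in [Ui]; this
   is the factor map [pi] onto [K]. Its fibre over [1] is a point, so any two
   points in a fibre are proximal and [K] is the maximal equicontinuous factor.
   Toeplitz points lie over the [y] with no [y^-1 (iota h)] in [D]; they miss a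
   set of positive measure.

   Write [D] as a decreasing intersection of clopen sets [D n], and let
   [g 0, g 1, ..] enumerate [G]. If, for every [z], at most one of
   [z (iota (g 0)), .., z (iota (g n))] lies in [U1] and [D n], then the
   translates by [g 0, .., g n] of [{x | x 1 = 1 and (pi x)^-1 in D n}] are
   disjoint, so every invariant measure gives this set mass at most
   [1 / (n + 1)]. Hence almost surely [x h = 0] whenever [(pi x)^-1 (iota h)] is
   in [D], i.e. [x] is a function of [pi x]. No amenability is involved.

   The sets [D n] are built by removing, at step [n], finitely many cosets of a
   small open normal subgroup: the coset of [iota (g n)], the coset of a point
   [v n], inside which a smaller coset is put in [U1] and the rest in [U0], and
   the translates of the coset of [v n] by quotients of [g 0, .., g n], put in
   [U0] to keep [U1] sparse. *)

Set Implicit Arguments.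
Unset Strict Implicit.
Unset Printing Implicit Defensive.

Import Order.TTheory GRing.Theory Num.Theory.

Local Open Scope classical_set_scope.
Local Open Scope group_scope.

(** * Open normal subgroups of a compact group *)

(** In a compact Hausdorff space the intersection [Q] of the clopen neighbourhoods of [x] is
    connected, so here it is reduced to [x]. *)
Lemma totally_disconnected_zero_dimensional (R : realType) (T : topologicalType) :
  hausdorff_space T -> compact [set: T] -> totally_disconnected [set: T] ->
  zero_dimensional T.
Proof.
move=> hT cT tdT x y xy; apply: contrapT => nsep.
pose Q := \bigcap_(U in [set U : set T | clopen U /\ U x]) U.
have Qx : Q x by move=> U [].
have clQ : closed Q by apply: closed_bigI => U [[]].
have Qy : Q y.
  by move=> U [cU Ux]; apply: contrapT => nUy; apply: nsep; exists U.
have split_empty A B : closed A -> closed B -> A `&` B = set0 ->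
    A `|` B = Q -> A x -> B = set0.
  move=> clA clB AB0 ABQ Ax.
  have [U [V [oU oV AU BV UV0]]] :
      exists U V, [/\ open U, open V, A `<=` U, B `<=` V & U `&` V = set0].
    have := (@normal_openP R T).1 (compact_normal hT cT).
    by apply.
  pose W := ~` (U `|` V).
  have clW : closed W by apply: open_closedC; exact: openU.
  (* Otherwise the traces on [W] of the clopen neighbourhoods of [x] generate a proper filter, and a
     cluster point of it lies in both [Q] and [W]. *)
  have [C [cC Cx CUV]] : exists C, [/\ clopen C, C x & C `<=` U `|` V].
    apply: contrapT => noC.
    pose F := filter_from [set C : set T | clopen C /\ C x] (fun C => C `&` W).
    have FF : ProperFilter F.
      apply: filter_from_proper; last first.
        move=> C [cC Cx]; apply: contrapT => /nonemptyPn CW; apply: noC.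
        exists C; split => // z Cz; apply: contrapT => nz.
        by have : (C `&` W) z by []; rewrite CW.
      apply: filter_from_filter.
        by exists setT; split => //; exact: clopenT.
      move=> C C' [cC Cx] [cC' C'x]; exists (C `&` C'); first split => //.
        exact: clopenI.
      by move=> z [[? ?] ?].
    have [|p [_ Fp]] := cT F _; first exact: filterT.
    have Wp : W p.
      apply: clW => N /Fp; apply; exists setT; last by move=> ? [].
      by split => //; exact: clopenT.
    have : Q p.
      move=> C [cC Cx]; apply: cC.2 => N /Fp; apply.
      by exists C => // z [].
    by rewrite -ABQ => -[/AU|/BV] ?; apply: Wp; [left|right].
  have QU : Q `<=` C `&` U.
    move=> z; apply; split; last by split => //; exact: AU.
    split; first by apply: openI => //; case: cC.
    (* Inside [C], the open set [U] is the complement of [V], hence also closed. *)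
    have -> : C `&` U = C `&` ~` V.
      apply/seteqP; split=> z' [Cz'].
        move=> Uz'; split => // Vz'.
        by have : (U `&` V) z' by []; rewrite UV0.
      by case: (CUV _ Cz').
    by apply: closedI; [case: cC | exact: open_closedC].
  apply/seteqP; split => // z Bz.
  have [_ Uz] : (C `&` U) z by apply: QU; rewrite -ABQ; right.
  have : (U `&` V) z by split => //; exact: BV.
  by rewrite UV0.
have cQ : connected Q.
  move=> B [b Bb] [C oC BC] [C' cC' BC'].
  have clB : closed B by rewrite BC'; exact: closedI.
  have clB' : closed (Q `\` B).
    have -> : Q `\` B = Q `&` ~` C.
      rewrite BC; apply/seteqP; split => z [Qz].
        by move=> nz; split => // Cz; apply: nz.
      by move=> nz; split => // -[].
    by apply: closedI => //; exact: open_closedC.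
  have BQ : B `<=` Q by rewrite BC => ? [].
  have [Bx|nBx] := pselect (B x).
    have := split_empty _ _ clB clB' (setDIK _ _) (setDUK BQ) Bx.
    by rewrite setD_eq0 => QB; apply/seteqP; split.
  suff B0 : B = set0 by rewrite B0 in Bb.
  apply: (split_empty _ _ clB' clB) => //.
    by rewrite setIC setDIK.
  by rewrite setUC setDUK.
have := tdT x I => /seteqP[/(_ y) + _] => /(_ _)/= yx.
by rewrite yx ?eqxx// in xy; exists Q.
Qed.

Section TopologicalGroup.
Variables (R : realType) (K : metricGroupType R).
Implicit Types (a x y z : K) (A N : set K).

Lemma metricGroup_hausdorff : hausdorff_space K.
Proof. exact: metric_hausdorff. Qed.

Lemma cvg_mulg (T : Type) (F : set_system T) {FF : Filter F} (u v : T -> K) x y :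
  u @ F --> x -> v @ F --> y -> (fun t => u t * v t) @ F --> x * y.
Proof.
move=> ux vy.
apply: (@cvg_comp _ _ _ (fun t => (u t, v t)) (fun xy : K * K => xy.1 * xy.2)).
  exact: cvg_pair ux vy.
exact: (mulg_continuous (x, y)).
Qed.

Lemma mulgr_continuous a : continuous (fun x => x * a).
Proof. by move=> x; apply: cvg_mulg; [exact: cvg_id|exact: cvg_cst]. Qed.

Lemma mulgl_continuous a : continuous (fun x => a * x).
Proof. by move=> x; apply: cvg_mulg; [exact: cvg_cst|exact: cvg_id]. Qed.

Definition open_normal N :=
  [/\ open N, is_subgroup N & forall x z, N x -> N (z * x * z^-1)].

Section OpenNormal.
Variable N : set K.
Hypothesis oN : open_normal N.

Lemma open_normalO : open N. Proof. by case: oN. Qed.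

Lemma open_normal1 : N 1. Proof. by case: oN => _ []. Qed.

Lemma open_normalM x y : N x -> N y -> N (x * y).
Proof. by case: oN => _ [_ + _] _; apply. Qed.

Lemma open_normalV x : N x -> N x^-1.
Proof. by case: oN => _ [_ _ +] _; apply. Qed.

Lemma open_normalJ x z : N x -> N (z * x * z^-1).
Proof. by case: oN => _ _ + ; apply. Qed.

Lemma open_normalJV x z : N x -> N (z^-1 * x * z).
Proof. by move=> /(@open_normalJ _ z^-1); rewrite invgK. Qed.

Lemma open_normalC x y : N (x * y) -> N (y * x).
Proof. by move=> /(@open_normalJ _ y); rewrite mulgA mulgK. Qed.

Lemma open_normal_trans x y z : N (x * y^-1) -> N (y * z^-1) -> N (x * z^-1).
Proof. by move=> xy /(open_normalM xy); rewrite mulgA mulgVK. Qed.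

Lemma open_normal_sym x y : N (x * y^-1) -> N (y * x^-1).
Proof. by move=> /open_normalV; rewrite invgM invgK. Qed.

Lemma open_coset y : open [set x | N (x * y^-1)].
Proof.
apply: (@open_comp _ _ (fun x => x * y^-1)); last exact: open_normalO.
by move=> x _; exact: mulgr_continuous.
Qed.

(** The set and its complement are both unions of cosets of [N], which are open. *)
Lemma closed_coset_invariant A :
  (forall a x, N a -> A x -> A (a * x)) -> open A /\ closed A.
Proof.
move=> NA; have oA B : (forall a x, N a -> B x -> B (a * x)) -> open B.
  move=> NB; rewrite openE => x Bx; rewrite /interior nbhsE.
  exists [set z | N (z * x^-1)] => [|z /= Nz].
    by split; [exact: open_coset|rewrite /= mulgV; exact: open_normal1].
  by rewrite -(mulgVK x z); exact: NB.
split; first exact: oA.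
rewrite -(setCK A); apply: open_closedC; apply: oA => a x Na nAx Aax.
by apply: nAx; rewrite -(mulKg a x); apply: NA => //; exact: open_normalV.
Qed.

Lemma finite_cosets : compact [set: K] ->
  exists s : seq K, forall x, exists2 r, r \in s & N (x * r^-1).
Proof.
rewrite compact_cover => /(_ K setT (fun r => [set x | N (x * r^-1)])).
case=> [r _|x _|s _ cov]; first exact: open_coset.
  by exists x => //=; rewrite mulgV; exact: open_normal1.
by exists (finmap.enum_fset s) => x; have [r rs Nr] := cov x I; exists r.
Qed.

End OpenNormal.

(* The elements [t] such that inserting [t] in a product does not affect its
   membership in a given clopen set form an open normal subgroup. *)
Lemma open_normal_basis : compact [set: K] -> totally_disconnected [set: K] ->
  forall A, nbhs 1 A -> exists2 N, open_normal N & N `<=` A.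
Proof.
move=> cK tdK A A1.
have zK : zero_dimensional K.
  apply: (totally_disconnected_zero_dimensional R) => //.
  exact: metricGroup_hausdorff.
have [U [U1 [oU cU]] UA] :=
  zero_dimensional_cvg metricGroup_hausdorff zK cK A1.
pose N := [set t | forall x y, U (x * t * y) <-> U (x * y)].
have sN : is_subgroup N.
  split=> [x y|s t Ns Nt x y|t Nt x y]; first by rewrite mulg1.
  - rewrite mulgA; apply: iff_trans (Nt _ _) _; exact: Ns.
  - by apply: iff_sym; have := Nt (x * t^-1) y; rewrite mulgVK.
have NJ t z : N t -> N (z * t * z^-1).
  move=> Nt x y; rewrite !mulgA -(mulgA (x * z * t)).
  by apply: iff_trans (Nt _ _) _; rewrite mulgA mulgK.
exists N; last first.
  by move=> t /(_ 1 1); rewrite !mulg1 mul1g => Nt; apply: UA; apply/Nt.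
split => //.
suff N1 : nbhs 1 N.
  rewrite openE => t Nt; rewrite /interior.
  have : nbhs t ((fun x => x * t^-1) @^-1` N).
    by apply: mulgr_continuous; rewrite mulgV.
  apply: filterS => s /= Ns; rewrite -(mulgVK t s).
  by case: sN => _ + _; apply.
(* Membership in the clopen set [U] is locally constant, so the equivalence holds for [(x, y)] near
   any pair [p] and [t] near [1]; compactness of [K * K] makes the condition on [t] uniform. *)
have cKK : compact [set: K * K] by rewrite -setXTT; exact: compact_setX.
have /compact_near_coveringP/(_ K (nbhs 1)
  (fun t (p : K * K) => U (p.1 * t * p.2) <-> U (p.1 * p.2))) := cKK.
move=> near_cov; apply: filterS (near_cov _ _) => [t Nt x y|p _].
  exact: (Nt (x, y)).
have cvgl : (fun q : (K * K) * K => q.1.1 * q.2 * q.1.2) @ (p, 1) -->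
    p.1 * 1 * p.2.
  apply: cvg_mulg; first apply: cvg_mulg.
  - exact: cvg_comp (@cvg_fst _ _ _ _ _) (@cvg_fst _ _ _ _ _).
  - exact: cvg_snd.
  - exact: cvg_comp (@cvg_fst _ _ _ _ _) (@cvg_snd _ _ _ _ _).
have cvgr : (fun q : (K * K) * K => q.1.1 * q.1.2) @ (p, 1) --> p.1 * p.2.
  apply: cvg_mulg.
  - exact: cvg_comp (@cvg_fst _ _ _ _ _) (@cvg_fst _ _ _ _ _).
  - exact: cvg_comp (@cvg_fst _ _ _ _ _) (@cvg_snd _ _ _ _ _).
rewrite mulg1 in cvgl.
have near_const (V : set K) : open V -> V (p.1 * p.2) ->
    \forall q \near (p, 1), V (q.1.1 * q.2 * q.1.2) /\ V (q.1.1 * q.1.2).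
  move=> oV Vp; have nV : nbhs (p.1 * p.2) V by apply: open_nbhs_nbhs; split.
  by apply: filterI; [exact: cvgl nV|exact: cvgr nV].
have [Up|nUp] := pselect (U (p.1 * p.2)).
  by have := near_const _ oU Up; apply: filterS => q [].
have := near_const _ (closed_openC cU) nUp.
by apply: filterS => q [n1 n2]; split => /= [/n1|/n2].
Qed.

End TopologicalGroup.

(** * Towers of open normal subgroups *)

Section Tower.
Variables (R : realType) (K : metricGroupType R).
Implicit Types (N : set K) (n : nat).

Definition index_ge N N' n := exists s : seq K,
  [/\ size s = n, uniq s, forall x, x \in s -> N x &
      forall x y, x \in s -> y \in s -> N' (x * y^-1) -> x = y].

Variables (G : groupType) (phi : {multiplicative G -> K}) (g : nat -> G).

Lemma multiplicative1 : phi 1 = 1.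
Proof. by apply: (mulgI (phi 1)); rewrite -gmulfM !mulg1. Qed.

Lemma multiplicativeV x : phi x^-1 = (phi x)^-1.
Proof.
by apply: (mulgI (phi x)); rewrite -gmulfM !mulgV multiplicative1.
Qed.

(** Two points [z * phi (g i)] with [i <= k] differ by a right factor [phi t] with [t] in this list,
    whence its use in [ones_sparse]. *)
Definition quotients k : seq G :=
  [seq (g i)^-1 * g j | i <- iota 0 k.+1, j <- iota 0 k.+1].

Lemma size_quotients k : size (quotients k) = (k.+1 * k.+1)%N.
Proof. by rewrite size_allpairs !size_iota. Qed.

Lemma mem_quotients k i j :
  (i <= k)%N -> (j <= k)%N -> (g i)^-1 * g j \in quotients k.
Proof.
move=> ik jk; apply/allpairsP; exists (i, j).
by split => //; rewrite mem_iota.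
Qed.

Lemma one_quotients k : 1 \in quotients k.
Proof. by rewrite -(mulVg (g 0)); exact: mem_quotients. Qed.

(* The number of cosets removed at step [k] of the construction below. *)
Definition cost k := (k.+1 * k.+1).+1.

(* [reps] and [rep] serve to detect translations preserving the colouring, see
   [ones_aperiodic]; the factors 8 keep the total Haar measure of the removed
   cosets below [1 / 2]. *)
Record tower := Tower {
  big : set K;
  reps : seq K;
  rep : K;
  level : nat -> set K;
  big_open_normal : open_normal big;
  level_open_normal : forall k, open_normal (level k);
  level0_sub : level 0 `<=` big;
  levelS_sub : forall k, level k.+1 `<=` level k;
  level_basis : forall A : set K, nbhs 1 A -> exists k, level k `<=` A;
  level_quotients : forall k t, t \in quotients k -> level k (phi t) -> t = 1;
  rep_in : rep \in reps;
  reps_notin_big : forall c, c \in reps -> ~ big c;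
  reps_rep : forall c, c \in reps -> big (c * rep^-1) -> c = rep;
  reps_cover : forall x, ~ big x -> exists2 c, c \in reps & big (x * c^-1);
  index_big : index_ge setT big 8;
  index_level0 : index_ge big (level 0) (8 * (size reps + cost 0));
  index_levelS : forall k, index_ge (level k) (level k.+1) (8 * cost k.+1)
}.

Hypotheses (compactK : compact [set: K])
  (disconnectedK : totally_disconnected [set: K])
  (infiniteG : infinite_set [set: G]) (phi_inj : injective phi).

(** Finitely many cosets of [N] cover [K], and the preimage of each is empty or a translate of that
    of [N]; were the latter finite, so would be [G]. *)
Lemma infinite_preimage N : open_normal N -> infinite_set [set x | N (phi x)].
Proof.
move=> oN finN; apply: infiniteG.
have [s cov] := finite_cosets oN compactK.
have -> : [set: G] = \bigcup_(r in [set` s]) [set x | N (phi x * r^-1)].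
  by apply/seteqP; split => // x _; have [r rs Nr] := cov (phi x); exists r.
apply: bigcup_finite; first exact: finite_seq.
move=> r _; have [[x0 Nx0]|none] := pselect (exists x, N (phi x * r^-1)).
  apply: sub_finite_set (finite_image (fun a => a * x0) finN) => x /= Nx.
  exists (x * x0^-1); last by rewrite mulgVK.
  rewrite /= gmulfM multiplicativeV; apply: (open_normal_trans oN Nx).
  exact: open_normal_sym.
by apply: (sub_finite_set (B := set0)) => // x Nx; apply: none; exists x.
Qed.

(** The index bound comes from [n] elements of [G] mapped into [N]: [N'] avoids the images of their
    nontrivial quotients, and of the nontrivial elements of [T]. *)
Lemma refine_open_normal N (A : set K) (T : seq G) n :
  open_normal N -> nbhs 1 A ->
  exists N', [/\ open_normal N', N' `<=` N, N' `<=` A,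
    forall t, t \in T -> N' (phi t) -> t = 1 & index_ge N N' n].
Proof.
move=> oN A1.
have [X XN Xn] := infinite_set_fset n (infinite_preimage oN).
pose s := take n (finmap.enum_fset X).
have us : uniq s by apply: take_uniq; exact: finmap.fset_uniq.
have sN x : x \in s -> N (phi x) by move=> /mem_take xX; exact: XN.
have szs : size s = n by rewrite size_takel.
pose T' := [seq t <- T ++ [seq x * y^-1 | x <- s, y <- s] | t != 1].
pose B := A `&` N `&` ~` [set phi t | t in [set` T']].
have B1 : nbhs 1 B.
  apply: filterI.
    apply: filterI => //; apply: open_nbhs_nbhs; split.
      exact: open_normalO.
    exact: open_normal1.
  apply: open_nbhs_nbhs; split.
    apply: closed_openC.
    have fc := (accessible_finite_set_closed (T := K)).1; apply: fc.
      by apply: hausdorff_accessible; exact: metricGroup_hausdorff.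
    by apply: finite_image; exact: finite_seq.
  move=> [t /=]; rewrite mem_filter => /andP[t1 _].
  by rewrite -multiplicative1 => /phi_inj te; rewrite te eqxx in t1.
have [N' oN' N'B] := open_normal_basis compactK disconnectedK B1.
have N'T t : t \in T ++ [seq x * y^-1 | x <- s, y <- s] -> N' (phi t) -> t = 1.
  move=> tT /N'B[_ nt]; apply/eqP; apply: contrapT => /negP t1.
  by apply: nt; exists t => //=; rewrite mem_filter t1.
exists N'; split => //.
- by move=> x /N'B[[]].
- by move=> x /N'B[[]].
- by move=> t tT; apply: N'T; rewrite mem_cat tT.
exists (map phi s); split.
- by rewrite size_map.
- by rewrite map_inj_uniq.
- by move=> _ /mapP[x xs ->]; exact: sN.
- move=> _ _ /mapP[x xs ->] /mapP[y ys ->].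
  rewrite -multiplicativeV -gmulfM => /N'T xy; congr (phi _).
  apply: divg1_eq; apply: xy; rewrite mem_cat; apply/orP; right.
  by apply/allpairsP; exists (x, y).
Qed.

Lemma open_normalT : open_normal [set: K].
Proof. by split => //; exact: openT. Qed.

Lemma towerP : inhabited tower.
Proof.
have [M [oM _ _ _ iM]] := refine_open_normal [::] 8 open_normalT filterT.
have [c0 nMc0] : exists c, ~ M c.
  have [[|x [|y s]] [//= _ /andP[xy _] _ sM]] := iM.
  apply: contrapT => /forallNP allM.
  have Mz z : M z by apply: contrapT; exact: allM.
  move: xy; rewrite (sM x y) ?inE ?eqxx ?orbT//.
have [s cov] := finite_cosets oM compactK.
(* Discarding each [r] in the coset of [c0] makes [c0] the only representative of its coset, as
   [reps_rep] demands. [C] is fixed before [L0], whose index depends on the size of [C]. *)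
pose C := c0 :: [seq r <- s | `[< ~ M r /\ ~ M (r * c0^-1) >]].
(* Balls of radius [1 / (k + 1)] force the levels to shrink to [1]. *)
have ballk k : nbhs (1 : K) (ball (1 : K) (k.+1%:R^-1 : R)).
  by apply: nbhsx_ballx; rewrite invr_gt0.
have [L0 [oL0 L0M L0b L0q iL0]] := refine_open_normal (quotients 0)
  (8 * (size C + cost 0)) oM (ballk 0).
have /choice[next nextP] : forall kN : nat * {N : set K | open_normal N},
    exists N' : {N : set K | open_normal N},
    [/\ sval N' `<=` sval kN.2, sval N' `<=` ball (1 : K) (kN.1.+2%:R^-1 : R),
      forall t, t \in quotients kN.1.+1 -> sval N' (phi t) -> t = 1 &
      index_ge (sval kN.2) (sval N') (8 * cost kN.1.+1)].
  move=> [k [N oN]].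
  have [N' [oN' ? ? ? ?]] := refine_open_normal (quotients k.+1)
    (8 * cost k.+1) oN (ballk k.+1).
  by exists (exist _ N' oN'); split.
pose L := fix L k : {N : set K | open_normal N} :=
  if k is k'.+1 then next (k', L k') else exist _ L0 oL0.
constructor; apply: (@Tower M C c0 (sval \o L)) => //.
- by move=> k /=; exact: svalP.
- by move=> k; case: (nextP (k, L k)).
- move=> A; rewrite -nbhs_ballE => -[e /= e0 eA].
  have [k ke] : exists k : nat, (k.+1%:R^-1 < e)%R.
    have [k _ ke] := near_infty_natSinv_lt (PosNum e0).
    by exists k; exact: (ke k (leqnn k)).
  exists k => x; have Lb : sval (L k) `<=` ball (1 : K) (k.+1%:R^-1 : R).
    by case: k {ke} => // k; case: (nextP (k, L k)).
  by move=> /Lb/(le_ball (ltW ke)); exact: eA.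
- by case=> [|k] //; case: (nextP (k, L k)).
- by rewrite mem_head.
- move=> c; rewrite inE => /orP[/eqP-> //|].
  by rewrite mem_filter => /andP[/asboolP[]].
- move=> c; rewrite inE => /orP[/eqP //|].
  by rewrite mem_filter => /andP[/asboolP[]].
- move=> x nMx; have [Mx0|nMx0] := pselect (M (x * c0^-1)).
    by exists c0; rewrite ?mem_head.
  have [r rs Mr] := cov x; exists r => //.
  rewrite inE mem_filter rs andbT; apply/orP; right; apply/asboolP; split.
    move=> rM; apply: nMx; rewrite -(mulgVK r x).
    exact: open_normalM.
  by move=> rM; apply: nMx0; exact: open_normal_trans rM.
- by move=> k; case: (nextP (k, L k)).
Qed.

End Tower.

(** * The two colour classes *)

Section Blocks.
Variables (R : realType) (K : metricGroupType R).
Implicit Types (N A : set K) (E : seq K).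

Definition blocks N E : set K := [set x | exists2 e, e \in E & N (x * e^-1)].

Lemma blocks_cons N e E :
  blocks N (e :: E) = [set x | N (x * e^-1)] `|` blocks N E.
Proof.
apply/seteqP; split=> x.
  move=> [e']; rewrite inE => /orP[/eqP->|e'E] Nx; first by left.
  by right; exists e'.
move=> [Nx|[e' e'E Nx]]; first by exists e; rewrite ?mem_head.
by exists e' => //; rewrite inE e'E orbT.
Qed.

Lemma blocks_nil N : blocks N [::] = set0.
Proof. by apply/seteqP; split => // x []. Qed.

Lemma blocks_invariant N E a x : open_normal N -> N a ->
  blocks N E (a * x) <-> blocks N E x.
Proof.
move=> oN Na; split => -[e eE Ne]; exists e => //; last first.
  by rewrite -mulgA; exact: open_normalM.
rewrite -(mulKg a (x * e^-1)); apply: (open_normalM oN).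
  exact: open_normalV.
by rewrite mulgA.
Qed.

(** Pigeonhole: translating a point of [A] by the [n] representatives gives points of [A] in
    distinct cosets of [N'], while [E] describes fewer than [n] cosets. *)
Lemma nonempty_setD_blocks N N' A E n :
  open_normal N' -> A !=set0 -> (forall a x, N a -> A x -> A (a * x)) ->
  index_ge N N' n -> (size E < n)%N -> (A `\` blocks N' E) !=set0.
Proof.
move=> oN' [p Ap] NA [s [szs us sN sN']] En; apply: contrapT => /nonemptyPn A0.
have /choice[e eP] : forall x, exists e, x \in s -> e \in E /\ N' (x * p * e^-1).
  move=> x; have [xs|] := boolP (x \in s); last by exists 1.
  apply: contrapT => ne.
  have : (A `\` blocks N' E) (x * p).
    split; first by apply: NA => //; exact: sN.
    by move=> [e eE Ne]; apply: ne; exists e.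
  by rewrite A0.
have : (size (map e s) <= size E)%N.
  apply: uniq_leq_size; last by move=> _ /mapP[x xs ->]; case: (eP x xs).
  rewrite map_inj_in_uniq// => x y xs ys exy; apply: sN' => //.
  have [_ Nx] := eP x xs; have [_ Ny] := eP y ys.
  rewrite -exy in Ny; have := open_normal_trans oN' Nx (open_normal_sym oN' Ny).
  by rewrite invgM mulgA mulgK.
by rewrite size_map szs leqNgt En.
Qed.

End Blocks.

(** * Step-by-step removal of cosets and the resulting colours *)

Section Construction.
Variables (R : realType) (K : metricGroupType R) (G : groupType).
Variables (phi : {multiplicative G -> K}) (g : nat -> G) (T : tower phi g).
Variable decode : nat -> nat * nat.
Local Notation L := (level T).

(* Aiming the markers at all basic open sets makes every point that remains
   undecided a boundary point of both colours. *)
Definition target k : set K :=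
  [set x | L (decode k).2 (x * (phi (g (decode k).1))^-1)].

(** A point of [A] in the target if there is one, otherwise any point of [A]; [1] is a mere default
    for empty [A]. *)
Definition choose_marker k (A : set K) : K :=
  xget (xget 1 A) (A `&` target k).

Definition removed k v : seq K :=
  phi (g k) :: [seq v * phi t | t <- quotients g k].

(** The initial removal prepares [ones_aperiodic]: in the cosets of [big] through [1] and [rep],
    only the small cosets of [reps] will be in [ones]. *)
Fixpoint undecided k : set K :=
  if k is k'.+1 then
    undecided k' `\`
      blocks (L k') (removed k' (choose_marker k' (undecided k')))
  else ~` (blocks (big T) [:: 1; rep T] `|` blocks (L 0) (reps T)).
Local Notation D := undecided.

Definition marker k := choose_marker k (D k).
Local Notation v := marker.

Definition limit_undecided : set K := \bigcap_k D k.

Definition ones : set K :=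
  blocks (L 0) (reps T) `|` \bigcup_k [set x | L k.+1 (x * (v k)^-1)].

Definition zeros : set K := ~` (ones `|` limit_undecided).

Local Notation oL := (level_open_normal T).
#[local] Hint Resolve big_open_normal level_open_normal : core.

Lemma level_sub j k : (j <= k)%N -> L k `<=` L j.
Proof.
move=> /subnK <-; elim: (k - j)%N => [|n IH] x //.
by rewrite addSn => /levelS_sub/IH.
Qed.

Lemma undecided_sub j k : (j <= k)%N -> D k `<=` D j.
Proof.
by move=> /subnK <-; elim: (k - j)%N => [|n IH] x //; rewrite addSn => -[/IH].
Qed.

Lemma undecided0_invariant a x : L 0 a -> D 0 x -> D 0 (a * x).
Proof.
move=> La Dx [|] /blocks_invariant bx; apply: Dx; [left|right]; apply: bx => //.
exact: level0_sub.
Qed.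

(** Everything removed up to step [k] is a union of cosets of [L k]. Invariance under this coarser
    level, rather than [L k.+1], leaves room for step [k.+1] in [undecided_nonempty]. *)
Lemma undecidedS_invariant k a x : L k a -> D k.+1 x -> D k.+1 (a * x).
Proof.
elim: k a x => [|k IH] a x La [Dx nb].
  split; first exact: undecided0_invariant.
  by move=> /(blocks_invariant _ _ (oL 0) La).
split; first by apply: IH => //; exact: levelS_sub.
by move=> /(blocks_invariant _ _ (oL k.+1) La).
Qed.

Lemma undecided_invariant k a x : L k a -> D k x -> D k (a * x).
Proof.
case: k => [|k] La; first exact: undecided0_invariant.
by apply: undecidedS_invariant; exact: levelS_sub.
Qed.

Lemma undecided_clopen k : open (D k) /\ closed (D k).
Proof.
by apply: (closed_coset_invariant (oL k)) => a x; exact: undecided_invariant.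
Qed.

Lemma size_removed k w : size (removed k w) = cost k.
Proof. by rewrite /removed -cat1s size_cat size_map size_quotients. Qed.

(** A coset of [L k] in [D k.+1] contains at least [8 * cost k.+1] cosets of [L k.+1], of which step
    [k.+1] removes at most [cost k.+1]. *)
Lemma undecided_nonempty k : D k !=set0.
Proof.
suff DS : D k.+1 !=set0 by case: DS => x [Dx _]; exists x.
elim: k => [|k IH].
  have [p [_ pb]] : ([set: K] `\` blocks (big T) [:: 1; rep T]) !=set0.
    apply: (nonempty_setD_blocks _ _ _ (index_big T)) => //.
    by exists 1.
  pose A := ~` blocks (big T) [:: 1; rep T].
  have A0 : A !=set0 by exists p.
  have MA a x : big T a -> A x -> A (a * x).
    move=> Ma Ax /blocks_invariant bx; apply: Ax; exact: bx.
  (* The small cosets of [reps] and those of step [0] are all cosets of [L 0], so they are counted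
     together. *)
  have [|q [Aq qb]] := nonempty_setD_blocks (E := reps T ++ removed 0 (v 0))
    (oL 0) A0 MA (index_level0 T).
    by rewrite size_cat size_removed ltn_Pmull// addnS.
  exists q; split; last first.
    by move=> [e eE Le]; apply: qb; exists e => //; rewrite mem_cat eE orbT.
  move=> [//|[e eE Le]]; apply: qb; exists e => //; by rewrite mem_cat eE.
have [|q qD] := nonempty_setD_blocks (E := removed k.+1 (v k.+1))
  (oL k.+1) IH (@undecidedS_invariant k) (index_levelS T k).
  by rewrite size_removed ltn_Pmull.
by exists q.
Qed.

Lemma marker_undecided k : D k (v k).
Proof.
rewrite /marker /choose_marker.
have Dx : D k (xget 1 (D k)) by apply: xgetPex; exact: undecided_nonempty.
by case: xgetP => [x -> []|].
Qed.

Lemma marker_target k : (D k `&` target k) !=set0 -> target k (v k).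
Proof. by move=> ne; have /(xgetPex (xget 1 (D k)))[] := ne. Qed.

Lemma near_marker_undecided k x : L k (x * (v k)^-1) -> D k x.
Proof.
move=> Lx; rewrite -(mulgVK (v k) x); apply: undecided_invariant => //.
exact: marker_undecided.
Qed.

Lemma near_marker_decided k x t : t \in quotients g k ->
  L k (x * (v k * phi t)^-1) -> ~ D k.+1 x.
Proof.
move=> tk Lx [_]; apply; exists (v k * phi t) => //.
by rewrite inE; apply/orP; right; apply/mapP; exists t.
Qed.

Lemma near_marker_decided1 k x : L k (x * (v k)^-1) -> ~ D k.+1 x.
Proof.
move=> Lx; apply: near_marker_decided (one_quotients g k) _.
by rewrite multiplicative1 mulg1.
Qed.

(** Whatever a marker colours at step [k] leaves [D k.+1], so a point still in [D n] can only be
    coloured at step [n] or later. *)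
Lemma ones_undecided n x : ones x -> D n x ->
  exists2 k, (n <= k)%N & L k.+1 (x * (v k)^-1).
Proof.
move=> [bx /(undecided_sub (leq0n n)) nb|[k _ Lx] Dx].
  by exfalso; apply: nb; right.
exists k => //; rewrite leqNgt; apply/negP => /undecided_sub/(_ _ Dx).
by apply: near_marker_decided1; exact: levelS_sub.
Qed.

Lemma ones_limit x : ones x -> ~ limit_undecided x.
Proof.
move=> [bx|[k _ Lx]] Dx; first by apply: (Dx 0 I); right.
by have := Dx k.+1 I; apply: near_marker_decided1; exact: levelS_sub.
Qed.

(** The coset of [L k] around [v k] lies in [D k] and misses [D k.+1], so neither an earlier nor a
    later marker puts a point of it in [ones]. *)
Lemma zeros_ring k x : L k (x * (v k)^-1) -> ~ L k.+1 (x * (v k)^-1) -> zeros x.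
Proof.
move=> Lx nLx [ox|Dx]; last by apply: (near_marker_decided1 Lx); exact: Dx.
have Dx := near_marker_undecided Lx.
have [j kj Lj] := ones_undecided ox Dx.
move: kj; rewrite leq_eqVlt => /orP[/eqP kj|kj].
  by apply: nLx; rewrite kj.
apply: (near_marker_decided1 Lx); apply: (undecided_sub kj).
by apply: near_marker_undecided; exact: levelS_sub.
Qed.

(** Outside [D k] only markers [v j] with [j < k] matter, and their cosets of [L j.+1] are unions of
    cosets of [L k]. *)
Lemma ones_invariant k a x : L k a -> ~ D k x -> ones (a * x) <-> ones x.
Proof.
have half b y : L k b -> ~ D k y -> ones y -> ones (b * y).
  move=> Lb nDy [by_|[j _ Lj]].
    by left; apply/(blocks_invariant _ _ (oL 0) (level_sub (leq0n k) Lb)).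
  right; exists j => //=; rewrite -mulgA; apply: open_normalM => //.
  have jk : (j < k)%N.
    rewrite ltnNge; apply/negP => kj; apply: nDy; apply: (undecided_sub kj).
    by apply: near_marker_undecided; exact: levelS_sub.
  exact: (level_sub jk Lb).
move=> La nDx; split; last exact: half.
have La' := open_normalV (oL k) La.
have := half _ (a * x) La'; rewrite mulKg; apply=> Dax; apply: nDx.
by rewrite -(mulKg a x); exact: undecided_invariant.
Qed.

(** A point outside the limit leaves some [D k], and then its whole coset of [L k] has one
    colour. *)
Lemma ones_zeros_open : open ones /\ open zeros.
Proof.
have nbhs_coset k x : nbhs x [set y | L k (y * x^-1)].
  apply: open_nbhs_nbhs; split; first exact: open_coset.
  by rewrite /= mulgV; exact: open_normal1.
have decided x : ~ limit_undecided x -> exists k, ~ D k x.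
  by move=> /existsNP[k /not_implyP[_ nDx]]; exists k.
split; rewrite openE => x; rewrite /interior.
  move=> ox; have [k nDx] := decided _ (ones_limit ox).
  apply: filterS (nbhs_coset k x) => y /= Ly.
  by rewrite -(mulgVK x y); apply/(ones_invariant Ly nDx).
move=> /not_orP[nox nDx]; have [k nDkx] := decided _ nDx.
apply: filterS (nbhs_coset k x) => y /= Ly; rewrite -(mulgVK x y).
move=> [/(ones_invariant Ly nDkx)//|/(_ k I)].
move=> /(undecided_invariant (open_normalV (oL k) Ly)).
by rewrite mulKg.
Qed.

(* A translation preserving the decided values fixes the coset of [big] by the
   choice of [reps], and then the coset of each level, since around [marker k]
   only the coset of level [k.+1] is not coloured by [zeros]. *)
Lemma ones_aperiodic t : (forall u, ones u -> ~ zeros (t * u)) -> t = 1.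
Proof.
move=> per.
have oM := big_open_normal T.
have bigrep x : blocks (big T) [:: 1; rep T] x -> ~ blocks (L 0) (reps T) x ->
    zeros x.
  move=> bx nx [ox|/(_ 0 I)]; last by apply; left.
  case: ox => [//|[k _ Lx]].
  have : D 0 x.
    apply: (undecided_sub (leq0n k)).
    by apply: near_marker_undecided; exact: levelS_sub.
  by apply; left.
have ones_reps c : c \in reps T -> ones c.
  move=> cT; left; exists c => //; rewrite mulgV; exact: open_normal1.
have tM : big T t.
  (* Otherwise some [c] in [reps] has [t * c] in [big], where every point is in [zeros]. *)
  apply: contrapT => ntM.
  have ntV : ~ big T t^-1 by move=> /(open_normalV oM); rewrite invgK.
  have [c cT] := reps_cover ntV.
  move=> /(open_normalV oM); rewrite invgM !invgK => /(open_normalC oM) tc.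
  apply: (per c (ones_reps _ cT)); apply: bigrep.
    by exists 1; rewrite ?mem_head// invg1 mulg1.
  move=> [c' c'T /level0_sub tc']; apply: (reps_notin_big c'T).
  rewrite -(mulgVK (t * c) c'); apply: open_normalM => //.
  exact: open_normal_sym.
have tL0 : L 0 t.
  (* [t * rep T] stays in the coset of [big] through [rep T], where only the coset of [L 0] through
     [rep T] is in [ones]. *)
  apply: contrapT => ntL.
  apply: (per _ (ones_reps _ (rep_in T))); apply: bigrep.
    by exists (rep T); rewrite ?inE ?eqxx ?orbT// mulgK.
  move=> [c cT Lc]; have cr : c = rep T.
    apply: (reps_rep cT); apply: (open_normal_trans oM (y := t * rep T)).
      by apply: open_normal_sym (level0_sub Lc).
    by rewrite mulgK.
  by apply: ntL; rewrite cr mulgK in Lc.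
have tL k : L k t.
  elim: k => // k IH; apply: contrapT => ntL.
  have ov : ones (v k).
    by right; exists k => //=; rewrite mulgV; exact: open_normal1.
  by apply: (per _ ov); apply: (@zeros_ring k); rewrite mulgK.
apply: (metricGroup_hausdorff (K := K)) => A B tA B1.
have : nbhs (1 : K) ((fun x => x * t) @^-1` A).
  by apply: mulgr_continuous; rewrite mul1g.
move=> /(level_basis T)[k kA].
exists 1; split; last exact: nbhs_singleton.
by have := kA t^-1 (open_normalV (oL k) (tL k)); rewrite /= mulVg.
Qed.

Lemma ones_sparse n z i j : (i <= n)%N -> (j <= n)%N ->
  ones (z * phi (g i)) -> D n (z * phi (g i)) ->
  ones (z * phi (g j)) -> D n (z * phi (g j)) -> g i = g j.
Proof.
move=> in_ jn oi Di oj Dj.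
have [a na La] := ones_undecided oi Di.
have [b nb Lb] := ones_undecided oj Dj.
wlog ab : i j in_ jn oi Di oj Dj a b na nb La Lb / (a <= b)%N.
  move=> wl; case/orP: (leq_total a b) => ab.
    exact: (wl i j _ _ _ _ _ _ a b).
  by apply/esym; apply: (wl j i _ _ _ _ _ _ b a).
pose s := (g i)^-1 * g j.
have sk : s \in quotients g a.
  by apply: mem_quotients; [exact: leq_trans na|exact: leq_trans na].
have zs : z * phi (g j) = z * phi (g i) * phi s.
  by rewrite -mulgA -gmulfM mulgA mulgV mul1g.
have Ls : L a.+1 (z * phi (g j) * (v a * phi s)^-1).
  by rewrite zs invgM mulgA mulgK.
move: ab; rewrite leq_eqVlt => /orP[/eqP ab|ab].
  (* Same marker: comparing [Ls] and [Lb] puts a conjugate of [phi s] in [L a.+1], which forces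
     [s = 1]. *)
  rewrite -ab in Lb.
  have := open_normal_trans (oL a.+1) (open_normal_sym (oL _) Ls) Lb.
  move=> /(open_normalJV (oL _) (v a)).
  rewrite mulgA mulgVK mulgA mulVg mul1g.
  move=> /levelS_sub/(level_quotients sk) s1.
  by rewrite -(mulVKg (g i) (g j)) -/s s1 mulg1.
(* Later marker: the second point lies in the coset of [v a * phi s], removed at step [a], but being
   close to [v b] it must still be in [D b]. *)
exfalso; apply: (near_marker_decided sk (levelS_sub Ls)).
apply: (undecided_sub ab).
by apply: near_marker_undecided; exact: levelS_sub.
Qed.

(** * Both colours near the points of the limit set *)

Hypothesis g_surj : forall x, exists k, g k = x.
Hypothesis phi_dense : dense (range phi).
Hypothesis decode_surj : forall p, exists k, decode k = p.

Lemma phi_decided x : ~ limit_undecided (phi x).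
Proof.
have [k <-] := g_surj x; move=> /(_ k.+1 I)[_]; apply.
by exists (phi (g k)); rewrite ?mem_head// mulgV; exact: open_normal1.
Qed.

Lemma dense_level k y : exists x, L k (phi x * y^-1).
Proof.
have [|z [Lz [x _ xz]]] := phi_dense _ (open_coset (oL k) y).
  by exists y; rewrite /= mulgV; exact: open_normal1.
by exists x; rewrite xz.
Qed.

Lemma level_strict k : exists2 a, L k a & ~ L k.+1 a.
Proof.
have [[|x [|y s]] [// sz /andP[xy _] sL sLS]] := index_levelS T k.
apply: contrapT => ne; move: xy; rewrite (sLS x y) ?inE ?eqxx ?orbT//.
apply: contrapT => nL; apply: ne; exists (x * y^-1) => //.
apply: open_normalM => //; first by apply: sL; rewrite mem_head.
by apply: open_normalV => //; apply: sL; rewrite !inE eqxx orbT.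
Qed.

(** The coset of [L m] through some [phi x] near [d] is the target of a step [k]; as it contains the
    undecided point [d], the marker [v k] lands in it. *)
Lemma limit_ones d (A : set K) : limit_undecided d -> nbhs d A ->
  (ones `&` A) !=set0.
Proof.
move=> Dd dA.
have : nbhs (1 : K) ((fun x => x * d) @^-1` A).
  by apply: mulgr_continuous; rewrite mul1g.
move=> /(level_basis T)[m mA].
have [x Lx] := dense_level m d.
have [i gi] := g_surj x; have [k dk] := decode_surj (i, m).
have tv : target k (v k).
  apply: marker_target; exists d; split; first exact: Dd.
  by rewrite /target dk /= gi; exact: open_normal_sym.
exists (v k); split.
  by right; exists k => //=; rewrite mulgV; exact: open_normal1.
rewrite /target dk /= gi in tv; rewrite -(mulgVK d (v k)); apply: mA.
exact: open_normal_trans tv Lx.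
Qed.

(** A point [phi x] near [d] is in [zeros], or else was coloured by a marker [v k]. Then [k >= m],
    since otherwise [d] would be in [ones] too, and the ring of [zeros] around [v k] is close to
    [d]. *)
Lemma limit_zeros d (A : set K) : limit_undecided d -> nbhs d A ->
  (zeros `&` A) !=set0.
Proof.
move=> Dd dA.
have : nbhs (1 : K) ((fun x => x * d) @^-1` A).
  by apply: mulgr_continuous; rewrite mul1g.
move=> /(level_basis T)[m mA].
have A' y : L m (y * d^-1) -> A y.
  by move=> /mA; rewrite /= mulgVK.
have [x Lx] := dense_level m d.
have [ox|nox] := pselect (ones (phi x)); last first.
  exists (phi x); split; last exact: A'.
  by move=> [//|]; exact: phi_decided.
have [bx|[k _ Lk]] := ox.
  exfalso; apply: (Dd 0 I); right.
  apply/(blocks_invariant _ _ (oL 0) (a := phi x * d^-1)); last by rewrite mulgVK.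
  exact: (level_sub (leq0n m)).
have km : (m <= k)%N.
  rewrite leqNgt; apply/negP => km; apply: ones_limit Dd.
  right; exists k => //; apply: open_normal_trans (Lk) => //.
  by apply: open_normal_sym => //; exact: (level_sub km).
have [a La nLa] := level_strict k.
exists (a * v k); split.
  by apply: (@zeros_ring k); rewrite mulgK.
apply: A'; apply: (open_normal_trans (oL m) (y := v k)).
  by rewrite mulgK; exact: (level_sub km).
apply: (open_normal_trans (oL m) (y := phi x)) => //.
by apply: (open_normal_sym (oL m)); exact: (level_sub (leqW km) Lk).
Qed.

End Construction.

(** * Haar measure of the undecided set *)

Lemma open_borel (X : ptopologicalType) (A : set X) :
  open A -> measurable (A : set (borel X)).
Proof. exact: sub_sigma_algebra. Qed.

Lemma closed_borel (X : ptopologicalType) (A : set X) :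
  closed A -> measurable (A : set (borel X)).
Proof.
move=> cA; rewrite -(setCK A); apply: measurableC; apply: open_borel.
exact: closed_openC.
Qed.

Lemma continuous_borel (X Y : ptopologicalType) (f : X -> Y) :
  continuous f -> measurable_fun setT (f : borel X -> borel Y).
Proof.
move=> cf.
apply: (@measurability _ _ (borel X) (borel Y) _ f (@open Y)) => // _ [B oB <-].
by rewrite setTI; apply: open_borel; apply: open_comp => // x _; exact: cf.
Qed.

(** * Real-valued probabilities *)

Section RealProbability.
Variables (d : measure_display) (X : measurableType d) (R : realType).
Variable P : probability X R.
Implicit Types A B : set X.
Local Open Scope ring_scope.

Definition prob A : R := fine (P A).

Lemma probE A : measurable A -> P A = (prob A)%:E.
Proof. by move=> mA; rewrite fineK// fin_num_measure. Qed.

Lemma prob_ge0 A : 0 <= prob A.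
Proof. by rewrite fine_ge0. Qed.

Lemma probU_le A B : measurable A -> measurable B ->
  prob (A `|` B) <= prob A + prob B.
Proof.
move=> mA mB; rewrite -lee_fin EFinD -!probE//; last exact: measurableU.
exact: measureU2.
Qed.

Lemma probU A B : measurable A -> measurable B -> A `&` B = set0 ->
  prob (A `|` B) = prob A + prob B.
Proof.
move=> mA mB AB; apply: EFin_inj; rewrite EFinD -!probE//; last exact: measurableU.
exact: measureU.
Qed.

Lemma prob_le A B : measurable A -> measurable B -> A `<=` B ->
  prob A <= prob B.
Proof.
by move=> mA mB AB; rewrite -lee_fin -!probE//; apply: le_measure; rewrite ?inE.
Qed.

Lemma prob_setT : prob setT = 1.
Proof. by rewrite /prob probability_setT. Qed.

Lemma prob_set0 : prob set0 = 0.
Proof. by rewrite /prob measure0. Qed.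

Lemma prob_setD_ge A B : measurable A -> measurable B ->
  prob A - prob B <= prob (A `\` B).
Proof.
move=> mA mB; rewrite lerBlDr.
apply: le_trans (probU_le (measurableD mA mB) mB).
apply: prob_le => //; first by apply: measurableU => //; exact: measurableD.
by move=> x Ax; have [|] := pselect (B x); [right|left].
Qed.

End RealProbability.

Section HaarMeasure.
Variables (R : realType) (K : metricGroupType R).
Variable nu : probability (borel K) R.
Hypothesis haar : haar_measure nu.
Implicit Types (N : set K) (E : seq K).
Local Notation vol := (prob nu).

Lemma open_blocks N E : open_normal N -> open (blocks N E).
Proof.
move=> oN; elim: E => [|e E IH]; first by rewrite blocks_nil; exact: open0.
by rewrite blocks_cons; apply: openU => //; exact: open_coset.
Qed.

(** The inverted form is [(z * c^-1)^-1]: compatibility involves the inverse of the point of [K],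
    and [c] accounts for an arbitrary factor map in [semicocycle_irregular]. *)
Lemma borel_divl (c : K) (A : set K) : open A ->
  measurable ([set z | A (c * z^-1)] : set (borel K)).
Proof.
move=> oA; apply: open_borel; apply: (@open_comp _ _ (fun z => c * z^-1)) => //.
move=> z _; apply: cvg_mulg; first exact: cvg_cst.
exact: (invg_continuous z).
Qed.

(** Normality of [N] moves the right factor [b] to the left, where invariance applies. *)
Lemma haar_coset N (a b : K) : open_normal N ->
  vol [set z | N (a * z * b)] = vol N.
Proof.
move=> oN; rewrite /prob -(haar (b * a) (open_borel (open_normalO oN))).
congr (fine (nu _)); apply/seteqP; split=> z /=.
  by move=> /(open_normalC oN); rewrite mulgA.
by rewrite -mulgA => /(open_normalC oN).
Qed.

Lemma haar_blocks_le N E (c : K) : open_normal N ->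
  (vol [set z | blocks N E (c * z^-1)%g] <= (size E)%:R * vol N)%R.
Proof.
move=> oN; elim: E => [|e E IH].
  by rewrite blocks_nil mul0r (_ : mkset _ = set0) ?prob_set0.
rewrite blocks_cons /= -natr1 mulrDl mul1r addrC.
have coset_vol : vol [set z | N (c * z^-1 * e^-1)%g] = vol N.
  rewrite -(haar_coset e c^-1 oN); congr prob.
  by apply/seteqP; split=> z /= /(open_normalV oN); rewrite !invgM !invgK !mulgA.
apply: le_trans (probU_le nu (borel_divl c (open_coset oN e))
  (borel_divl c (open_blocks E oN))) _.
by rewrite lerD// coset_vol.
Qed.

Lemma haar_index N N' n : open_normal N -> open_normal N' -> N' `<=` N ->
  index_ge N N' n -> (n%:R * vol N' <= vol N)%R.
Proof.
move=> oN oN' N'N [s [<- us sN sN']].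
have -> : ((size s)%:R * vol N')%R = vol (blocks N' s).
  elim: s us sN sN' => [|x s IH] /=.
    by rewrite blocks_nil mul0r prob_set0.
  move=> /andP[xs us] sN sN'; rewrite blocks_cons probU.
  - rewrite -natr1 mulrDl mul1r addrC; congr (_ + _)%R.
      rewrite -(haar_coset 1 x^-1 oN'); congr prob.
      by apply/seteqP; split => z /=; rewrite mul1g.
    apply: IH => //.
      by move=> y ys; apply: sN; rewrite inE ys orbT.
    by move=> y z ys zs; apply: sN'; rewrite inE ?ys ?zs orbT.
  - by apply: open_borel; exact: open_coset.
  - by apply: open_borel; exact: open_blocks.
  - apply/seteqP; split => // z [/= Nx [y ys Ny]].
    have xy : x = y.
      apply: sN'; rewrite ?mem_head ?inE ?ys ?orbT//.
      exact: open_normal_trans (open_normal_sym oN' Nx) Ny.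
    by rewrite xy ys in xs.
apply: prob_le.
- by apply: open_borel; exact: open_blocks.
- by apply: open_borel; exact: open_normalO.
- move=> z [x xs /N'N Nz]; rewrite -(mulgVK x z).
  by apply: open_normalM => //; exact: sN.
Qed.

Variables (G : groupType) (phi : {multiplicative G -> K}) (g : nat -> G).
Variables (T : tower phi g) (decode : nat -> nat * nat) (c : K).
Local Notation L := (level T).
Local Notation D := (undecided T decode).
#[local] Hint Resolve big_open_normal level_open_normal : core.

Let vol_level k : ((8 * cost k)%:R * vol (L k) <=
  vol (if k is k'.+1 then L k' else big T))%R.
Proof.
case: k => [|k]; last first.
  by apply: haar_index => //; [exact: levelS_sub|exact: index_levelS].
apply: le_trans (haar_index _ _ (@level0_sub _ _ _ _ _ T) (index_level0 T)) => //.
by rewrite ler_wpM2r ?prob_ge0// ler_nat leq_mul2l leq_addl orbT.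
Qed.

Lemma haar_undecided k : (2^-1 <= vol [set z | D k (c * z^-1)%g])%R.
Proof.
have mD k' : measurable ([set z | D k' (c * z^-1)%g] : set (borel K)).
  by apply: borel_divl; case: (undecided_clopen T decode k').
have stepD k' : (vol [set z | D k' (c * z^-1)%g] -
    (cost k')%:R * vol (L k') <= vol [set z | D k'.+1 (c * z^-1)%g])%R.
  rewrite -(size_removed phi g k' (marker T decode k')).
  apply: le_trans (lerB (lexx _) (haar_blocks_le _ c _)) _ => //.
  apply: prob_setD_ge => //.
  exact: (borel_divl c (open_blocks _ (level_open_normal T k'))).
have cost1 k' : (1 <= (cost k')%:R :> R)%R by rewrite ler1n.
have volL k' : (8 * ((cost k')%:R * vol (L k')) <=
    vol (if k' is k''.+1 then L k'' else big T))%R.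
  by have := vol_level k'; rewrite natrM mulrA.
have volL0 k' : (0 <= vol (L k'))%R by exact: prob_ge0.
have volL1 k' : (vol (L k') <= (cost k')%:R * vol (L k'))%R by rewrite ler_peMl.
have volM : (8 * vol (big T) <= 1)%R.
  have := haar_index (@open_normalT _ _) (big_open_normal T) (@subsetT _ _)
    (index_big T).
  by rewrite prob_setT.
(* The two cosets of [big] have measure at most [1 / 8] each, which leaves [3 / 4]; the other
   [1 / 8] is more than enough for the small cosets of [reps]. *)
have D0 : (3 / 4 - 1 / 8 <= vol [set z | D 0 (c * z^-1)%g])%R.
  have oB := open_blocks [:: 1; rep T] (big_open_normal T).
  have oC := open_blocks (reps T) (level_open_normal T 0).
  have mT : measurable [set: borel K] by exact: measurableT.
  have := prob_setD_ge nu mT (borel_divl c oB).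
  have := prob_setD_ge nu (measurableD mT (borel_divl c oB))
    (borel_divl c oC).
  rewrite prob_setT (_ : _ `\` _ `\` _ = [set z | D 0 (c * z^-1)%g]); last first.
    apply/seteqP; split=> [z [[_ nB] nC]|z /= nD].
      by move=> [bz|bz]; [exact: nB|exact: nC].
    by split; [split => // bz|move=> bz]; apply: nD; [left|right].
  have := haar_blocks_le [:: 1; rep T] c (big_open_normal T).
  have := haar_blocks_le (reps T) c (level_open_normal T 0).
  have : (0 <= (cost 0)%:R * vol (L 0))%R by rewrite mulr_ge0.
  have := haar_index (big_open_normal T) (level_open_normal T 0)
    (@level0_sub _ _ _ _ _ T) (index_level0 T).
  rewrite natrM -mulrA natrD (mulrDl (size (reps T))%:R%R).
  set C := ((size (reps T))%:R * _)%R; rewrite [size [:: 1; rep T]]/=; lra.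
(* The surplus [vol (L k')] pays for the later steps: step [k'.+1] costs at most an eighth of it and
   must leave [vol (L k'.+1)]. *)
have claim k' : (2^-1 + vol (L k') <= vol [set z | D k'.+1 (c * z^-1)%g])%R.
  elim: k' => [|k' IH].
    by have := stepD 0; have := volL 0; have := volL1 0; lra.
  have := stepD k'.+1; have := volL k'.+1; have := volL1 k'.+1.
  by have := volL0 k'; lra.
apply: (@le_trans _ _ (vol [set z | D k.+1 (c * z^-1)%g])).
  by have := claim k; have := volL0 k; lra.
by apply: prob_le => // z; exact: undecided_sub.
Qed.

End HaarMeasure.

(** * Compact systems *)

Lemma nbhs_subset (T : topologicalType) (x : T) (A B : set T) :
  A `<=` B -> nbhs x A -> nbhs x B.
Proof. exact: filterS. Qed.

Section CompactTopology.
Variables (X Y : topologicalType).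

Lemma compact_set_type (A : set X) : compact A -> compact [set: set_type A].
Proof.
move=> cA F FF _; have [|p [Ap Fp]] := cA (set_val @ F) _.
  by apply: (@filterS _ F _ setT) => [x _|]; [exact: set_valP|exact: filterT].
exists (exist (fun x => x \in A) p (mem_set Ap)); split => //.
move=> U V FU [_ [[W oW <-] /= Wp] WV].
have FU' : (set_val @ F) (set_val @` U).
  by apply: (@filterS _ F _ U) => // x Ux; exists x.
have nW : nbhs p W by apply: open_nbhs_nbhs; split.
have [_ [[x Ux <-] Wx]] := Fp _ _ FU' nW.
by exists x; split => //; exact: WV.
Qed.

(** A continuous map from a compact space to a Hausdorff space is closed, so a neighbourhood of a
    fibre contains all nearby fibres. *)
Lemma near_fiber (f : X -> Y) (y0 : Y) (N : set X) : compact [set: X] ->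
  hausdorff_space Y -> continuous f -> (forall x, f x = y0 -> nbhs x N) ->
  \forall y \near y0, forall x, f x = y -> N x.
Proof.
move=> /compact_near_coveringP cX hY fc fN.
suff : \forall y \near nbhs y0, [set: X] `<=` (fun x => f x = y -> N x).
  by apply: filterS => y Ny x; exact: Ny.
apply: (cX Y (nbhs y0) (fun y x => f x = y -> N x)) => x _.
have [fx|/eqP fx] := pselect (f x = y0).
  exists (N, setT) => /=; first by split; [exact: fN|exact: filterT].
  by move=> [x' y] /= [Nx _] _.
move: hY; rewrite open_hausdorff => /(_ _ _ fx)[[A B] /= [Ax By] [oA oB AB]].
exists (f @^-1` A, B) => /=.
  split; last by apply: open_nbhs_nbhs; split => //; exact: set_mem.
  by apply: fc; apply: open_nbhs_nbhs; split => //; exact: set_mem.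
move=> [x' y] /= [Afx By'] fxy; move/eqP: AB => /seteqP[/(_ y)] AB _.
by exfalso; apply: AB; split => //; rewrite -fxy.
Qed.

End CompactTopology.

(** * Arrays and their orbit closures *)

Section Arrays.
Variable G : groupType.
Implicit Types (x : array G) (h : G).

Lemma array_coord_continuous h : continuous (fun x => x h : bool).
Proof. by move=> x; exact: (@proj_continuous G (fun=> bool) h x). Qed.

Lemma near_array_coord x h : \forall x' \near x, x' h = x h.
Proof.
have xh : nbhs (x h : bool) [set x h].
  by apply: open_nbhs_nbhs; split => //; exact: discrete_open.
exact: (@array_coord_continuous h x _ xh).
Qed.

Lemma array_coord_clopen h :
  open [set x : array G | x h] /\ closed [set x : array G | x h].
Proof.
have oh (b : bool) : open [set x : array G | x h = b].
  rewrite openE => x xb; apply: nbhs_subset (near_array_coord x h) => x' x'h.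
  by rewrite /= x'h.
split; first exact: oh true.
have -> : [set x : array G | x h] = ~` [set x : array G | x h = false].
  by apply/seteqP; split=> x /=; case: (x h).
by apply: open_closedC; exact: oh.
Qed.

Lemma near_cylinder (g : nat -> G) (W : set (array G)) x :
  (forall k, exists n, g n = k) -> open W -> W x ->
  exists n, [set x' | forall i, (i < n)%N -> x' (g i) = x (g i)] `<=` W.
Proof.
move=> g_surj oW Wx.
pose cyl n : set (array G) :=
  [set x' | forall i, (i < n)%N -> x' (g i) = x (g i)].
pose F := filter_from [set: nat] cyl.
have FF : Filter F.
  apply: filter_from_filter => [|m n _ _]; first by exists 0.
  exists (maxn m n) => // x' x'E; split => i lt_i; apply: x'E.
    by rewrite leq_max lt_i.
  by rewrite leq_max lt_i orbT.
have Fx : F --> x.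
  apply/cvg_sup => i U [_ [[B oB <-] Bx] BU].
  have [n gn] := g_surj i; exists n.+1 => // x' x'E; apply: BU => /=.
  by move: Bx; rewrite /= -gn -(x'E n).
have [|n _ nW] := Fx W; last by exists n.
by apply: open_nbhs_nbhs; split.
Qed.

Lemma array_compact : compact [set: array G].
Proof.
have := @tychonoff G (fun=> bool) (fun=> setT) (fun=> bool_compact).
by congr compact; apply/seteqP; split.
Qed.

Lemma orbit_closure_closed x : closed (orbit_closure x).
Proof. exact: closed_closure. Qed.

Lemma orbit_closure_compact x : compact [set: orbit_closure_space x].
Proof.
apply: compact_set_type; apply: subclosed_compact array_compact _ => //.
exact: orbit_closure_closed.
Qed.

Lemma val_continuous x : continuous (val : orbit_closure_space x -> array G).
Proof. exact: initial_continuous. Qed.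

Lemma sigma_orbit_dense x (A : set (orbit_closure_space x)) :
  open A -> A !=set0 -> exists k, A (sigma k (orbit_base x)).
Proof.
move=> [W oW <-] [z Wz].
have [|_ [[k _ <-] Wk]] := set_mem (valP z) W; last by exists k.
by apply: open_nbhs_nbhs; split.
Qed.

Lemma sigma_action x : continuous_action (@sigma G x).
Proof.
split.
- move=> y; apply: val_inj; apply/funext => h /=.
  by rewrite /array_shift invg1 mul1g.
- by move=> k h y; apply: val_inj; rewrite /= shiftM.
move=> k y U [_ [[W oW <-] /= Wy] WU].
have ck : (array_shift k \o val) @ y --> array_shift k (val y).
  apply: continuous_comp; first exact: val_continuous.
  exact: shift_continuous.
have nW : nbhs (array_shift k (val y)) W by apply: open_nbhs_nbhs; split.
apply: (@filterS _ (nbhs y) _ ((array_shift k \o val) @^-1` W)) => [z Wz|].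
  exact: (WU (sigma k z)).
exact: ck nW.
Qed.

End Arrays.

Section Translation.
Variables (R : realType) (G : groupType) (K : metricGroupType R).
Variable phi : {multiplicative G -> K}.

(** By compactness, left multiplications by all [a] in [K], not only those from [G], are
    equicontinuous. *)
Lemma translation_equicontinuous :
  compact [set: K] -> equicontinuous_system (translation phi).
Proof.
move=> cK; split => //.
  split=> [y|k h y|k]; rewrite /translation.
  - by rewrite multiplicative1 mul1g.
  - by rewrite gmulfM mulgA.
  - exact: mulgl_continuous.
move=> y E entE; have /compact_near_coveringP nearK := cK.
suff : \forall y' \near nbhs y, [set: K] `<=` (fun a => E (a * y, a * y')).
  by apply: filterS => y' Ey k _; exact: Ey.
apply: (nearK K (nbhs y) (fun y' a => E (a * y, a * y'))) => a _.
have entE' := entourage_split_ent entE.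
have ul : (fun p : K * K => p.1 * y) @ (a, y) --> a * y.
  by apply: cvg_mulg; [exact: cvg_fst|exact: cvg_cst].
have ur : (fun p : K * K => p.1 * p.2) @ (a, y) --> a * y.
  by apply: cvg_mulg; [exact: cvg_fst|exact: cvg_snd].
have /cvg_entourageP/(_ _ (entourage_inv entE')) El := ul.
have /cvg_entourageP/(_ _ entE') Er := ur.
have FF : Filter (nbhs (a, y)) := nbhs_filter (a, y).
have /(@filterS _ _ FF) near_split :
    (fun p : K * K => split_ent E (p.1 * y, a * y))
    `&` (fun p => split_ent E (a * y, p.1 * p.2))
    `<=` (fun p => E (p.1 * y, p.1 * p.2)).
  by move=> p [lp rp]; exact: (entourage_split (a * y) entE).
apply: near_split; exact: (@filterI _ _ FF _ _ El Er).
Qed.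

End Translation.

(** * Semicocycle extensions *)

Section Semicocycle.
Variables (R : realType) (G : groupType) (K : metricGroupType R).
Variable phi : {multiplicative G -> K}.
Hypotheses (compactK : compact [set: K]) (phi_dense : dense (range phi)).
Variables U1 U0 : set K.
Hypotheses (openU1 : open U1) (openU0 : open U0)
  (disjoint01 : forall x, U1 x -> ~ U0 x)
  (phi_colored : forall k, U1 (phi k) \/ U0 (phi k))
  (aperiodic : forall t, (forall u, U1 u -> ~ U0 (t * u)) -> t = 1)
  (boundary1 : forall d A, ~ U1 d -> ~ U0 d -> nbhs d A -> (U1 `&` A) !=set0)
  (boundary0 : forall d A, ~ U1 d -> ~ U0 d -> nbhs d A -> (U0 `&` A) !=set0).

Definition semicocycle_array : array G := fun h => `[< U1 (phi h) >].
Local Notation eta := semicocycle_array.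
Local Notation X := (orbit_closure_space eta).

Definition compatible (x : array G) (y : K) := forall h,
  (U1 (y^-1 * phi h) -> x h) /\ (U0 (y^-1 * phi h) -> ~~ x h).

Lemma mulVphi k h : (phi k)^-1 * phi h = phi (k^-1 * h).
Proof. by rewrite gmulfM multiplicativeV. Qed.

Lemma compatible_shift x y k :
  compatible x y -> compatible (array_shift k x) (phi k * y).
Proof.
by move=> xy h; rewrite invgM -mulgA mulVphi; exact: xy.
Qed.

Lemma compatible_base : compatible eta 1.
Proof.
move=> h; rewrite invg1 mul1g; split=> Uh; first exact/asboolP.
by apply/negP => /asboolP/disjoint01; apply.
Qed.

Lemma dense_phi (A : set K) : open A -> A !=set0 -> exists k, A (phi k).
Proof.
by move=> oA A0; have [z [Az [k _ kz]]] := phi_dense A0 oA; exists k; rewrite kz.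
Qed.

Lemma open_mulgl (A : set K) a : open A -> open [set z | A (a * z)].
Proof.
by move=> oA; apply: (@open_comp _ _ (fun z => a * z)) => // z _;
  exact: mulgl_continuous.
Qed.

(** For distinct [y] and [y'], aperiodicity gives a nonempty open set of points to which they assign
    opposite colours; by density it contains some [phi k], so [x k] would have two values. *)
Lemma compatible_unique x y y' : compatible x y -> compatible x y' -> y = y'.
Proof.
move=> xy xy'; suff : y'^-1 * y = 1.
  by move=> /(congr1 (fun t => y' * t)); rewrite mulVKg mulg1.
apply: aperiodic => u Uu U0u.
have [] := @dense_phi ([set z | U0 (y'^-1 * z)] `&` [set z | U1 (y^-1 * z)]).
- by apply: openI; exact: open_mulgl.
- by exists (y * u); rewrite /= mulgA mulKg.
by move=> k [/(xy' k).2 nxk /(xy k).1 xk]; rewrite xk in nxk.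
Qed.

(** Incompatibility is witnessed by a single coordinate of [x] and an open condition on [y], so
    compatibility is a closed relation. *)
Lemma near_incompatible x y : ~ compatible x y ->
  \forall x' \near x & y' \near y, ~ compatible x' y'.
Proof.
move=> /existsNP[h bad].
have inv_cvg (U : set K) : open U -> U (y^-1 * phi h) ->
    \forall y' \near y, U (y'^-1 * phi h).
  move=> oU Uy; have cv : (fun y' => y'^-1 * phi h) @ y --> y^-1 * phi h.
    by apply: cvg_mulg; [exact: invg_continuous|exact: cvg_cst].
  by apply: cv; apply: open_nbhs_nbhs; split.
have xh := near_array_coord x h.
have [U1h|nU1h] := pselect (U1 (y^-1 * phi h)).
  exists ([set x' | x' h = x h], [set y' | U1 (y'^-1 * phi h)]) => /=.
    by split => //; exact: inv_cvg.
  move=> [x' y'] /= [x'h U1h'] /(_ h)[/(_ U1h') + _]; rewrite x'h => xh1.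
  by apply: bad; split => // /(disjoint01 U1h).
have [U0h|nU0h] := pselect (U0 (y^-1 * phi h)); last by exfalso; apply: bad.
exists ([set x' | x' h = x h], [set y' | U0 (y'^-1 * phi h)]) => /=.
  by split => //; exact: inv_cvg.
move=> [x' y'] /= [x'h U0h'] /(_ h)[_ /(_ U0h')]; rewrite x'h => xh1.
by apply: bad; split.
Qed.

(** By compactness of [K], incompatibility with every [y] would pass to all arrays near [x], but
    shifts of [eta] are compatible with points of [phi G]. *)
Lemma compatible_ex x : orbit_closure eta x -> exists y, compatible x y.
Proof.
move=> cx; apply: contrapT => /forallNP none.
have /compact_near_coveringP near_cov := compactK.
have nx : nbhs x [set x' | [set: K] `<=` (fun y => ~ compatible x' y)].
  apply: (near_cov (array G) (nbhs x) (fun x' y => ~ compatible x' y)) => y _.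
  have [[A B] /= [Ax By] AB] := near_incompatible (none y).
  by exists (B, A) => // -[y' x'] /= [By' Ax']; exact: (AB (x', y')).
have [_ [[k _ <-]]] := cx _ nx.
move=> /(_ (phi k * 1) I); apply; apply: compatible_shift.
exact: compatible_base.
Qed.

Definition semicocycle_factor (x : X) : K := xget 1 (compatible (val x)).
Local Notation pi := semicocycle_factor.

Lemma semicocycle_factorP x : compatible (val x) (pi x).
Proof.
have /compatible_ex ex := set_mem (valP x).
exact: (xgetPex 1 ex).
Qed.

Lemma semicocycle_factor_eq x y : compatible (val x) y -> pi x = y.
Proof. exact: compatible_unique (semicocycle_factorP x). Qed.

Lemma semicocycle_factor_sigma k x : pi (sigma k x) = phi k * pi x.
Proof.
apply: semicocycle_factor_eq; apply: compatible_shift.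
exact: semicocycle_factorP.
Qed.

Lemma semicocycle_factor_base : pi (orbit_base eta) = 1.
Proof. by apply: semicocycle_factor_eq; exact: compatible_base. Qed.

(** The graph is closed and the target compact. *)
Lemma semicocycle_factor_continuous : continuous pi.
Proof.
move=> x A; rewrite nbhsE => -[B [oB Bx] BA].
have clB : compact (~` B).
  by apply: subclosed_compact compactK _ => //; exact: open_closedC.
have /compact_near_coveringP near_cov := clB.
have nx : nbhs x [set x' : X | ~` B `<=` (fun y => ~ compatible (val x') y)].
  apply: (near_cov X (nbhs x) (fun x' y => ~ compatible (val x') y)) => y nBy.
  have [|[C E] /= [Cx Ey] CE] := @near_incompatible (val x) y.
    by move=> /semicocycle_factor_eq xy; apply: nBy; rewrite -xy.
  exists (E, val @^-1` C) => /=; first split => //.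
    exact: (@val_continuous _ _ x _ Cx).
  by move=> [y' x'] /= [Ey' Cx']; exact: (CE (val x', y')).
have sub : [set x' : X | ~` B `<=` (fun y => ~ compatible (val x') y)] `<=`
    pi @^-1` A.
  move=> x' nx'; apply: BA; apply: contrapT => nB.
  exact: nx' nB (semicocycle_factorP x').
exact: (nbhs_subset sub nx).
Qed.

Lemma semicocycle_factor_map : factor_map (@sigma G eta) (translation phi) pi.
Proof.
split; [exact: semicocycle_factor_continuous| |exact: semicocycle_factor_sigma].
have clr : closed (range pi).
  apply: compact_closed; first exact: metricGroup_hausdorff.
  apply: continuous_compact; last exact: orbit_closure_compact.
  by apply: continuous_subspaceT; exact: semicocycle_factor_continuous.
apply/seteqP; split => // y _; apply: clr => A; rewrite nbhsE => -[B [oB By] BA].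
have [k Bk] := dense_phi oB (ex_intro _ y By).
exists (phi k); split; last exact: BA.
exists (sigma k (orbit_base eta)) => //.
by rewrite semicocycle_factor_sigma semicocycle_factor_base mulg1.
Qed.

(** * The maximal equicontinuous factor *)

Definition never_undecided (y : K) :=
  forall h, U1 (y^-1 * phi h) \/ U0 (y^-1 * phi h).

Lemma never_undecided_fiber x x' : never_undecided (pi x) -> pi x = pi x' ->
  x = x'.
Proof.
move=> ny xx'; apply: val_inj; apply/funext => h.
have px := semicocycle_factorP x h; have px' := semicocycle_factorP x' h.
rewrite -xx' in px'.
case: (ny h) => Uh; first by rewrite (px.1 Uh) (px'.1 Uh).
by rewrite (negbTE (px.2 Uh)) (negbTE (px'.2 Uh)).
Qed.

Lemma never_undecided1 : never_undecided 1.
Proof. by move=> h; rewrite invg1 mul1g; exact: phi_colored. Qed.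

(* Points in a common fibre of [pi] can be moved simultaneously close to the
   base point, the only point above [1], so an equicontinuous factor identifies
   them. *)
Lemma equicontinuous_factor_fiber (Z : pmetricType R) (actZ : G -> Z -> Z)
    (q : X -> Z) (x x' : X) :
  equicontinuous_system actZ -> factor_map (@sigma G eta) actZ q ->
  pi x = pi x' -> q x = q x'.
Proof.
move=> [_ [act1 actM _] equiZ] [cq _ qE] xx'.
apply: (@close_eq _ (@metric_hausdorff R Z)); rewrite entourage_close => E entE.
have entE' := entourage_split_ent entE.
pose z0 := q (orbit_base eta).
pose W := [set z | forall k, split_ent E (actZ k z0, actZ k z) /\
  split_ent E (actZ k z, actZ k z0)].
have nW : nbhs z0 W.
  apply: nbhs_subset (equiZ z0 _ (filterI entE' (entourage_inv entE'))).
  by move=> z nz k; have [] := nz k I.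
have nearW : nbhs (1 : K) [set y | forall x, pi x = y -> W (q x)].
  apply: (near_fiber (@orbit_closure_compact _ eta)
    (@metricGroup_hausdorff _ K) semicocycle_factor_continuous) => z z1.
  apply: cq; suff -> : z = orbit_base eta by [].
  apply: never_undecided_fiber; first by rewrite z1; exact: never_undecided1.
  by rewrite z1 semicocycle_factor_base.
move: nearW; rewrite nbhsE => -[B [oB B1] BW].
have [||k Bk] := @dense_phi ((fun a => a * pi x) @^-1` B).
- by apply: open_comp => // z _; exact: mulgr_continuous.
- by exists (pi x)^-1; rewrite /= mulVg.
have Wx z : pi z = pi x ->
    split_ent E (actZ k^-1 z0, q z) /\ split_ent E (q z, actZ k^-1 z0).
  move=> zx; have := BW _ Bk (sigma k z); rewrite semicocycle_factor_sigma zx.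
  by move=> /(_ erefl)/(_ k^-1); rewrite qE -actM mulVg act1.
apply: (entourage_split (actZ k^-1 z0) entE).
  by have [] := Wx x.
by have [] := Wx x'.
Qed.

Lemma semicocycle_maximal :
  maximal_equicontinuous_factor (@sigma G eta) (translation phi) pi.
Proof.
split; [exact: translation_equicontinuous|exact: semicocycle_factor_map|].
move=> Z actZ q eqZ fq; have [cpi pi_onto _] := semicocycle_factor_map.
have pi_ex y : exists x, pi x = y.
  have : range pi y by rewrite pi_onto.
  by move=> [x _ xy]; exists x.
have [s sP] := choice pi_ex.
have qs x : q x = q (s (pi x)).
  by apply: (equicontinuous_factor_fiber eqZ fq); rewrite sP.
have [cq q_onto qE] := fq.
(* The section [s] need not be continuous; [q \o s] is, because [q] is constant on the fibres of
   [pi] and [near_fiber] applies. *)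
exists (q \o s); last by apply/funext => x; exact: qs.
split.
- move=> y A qA.
  have near_y : \forall y' \near y, forall x, pi x = y' -> A (q x).
    apply: (near_fiber (@orbit_closure_compact _ eta)
      (@metricGroup_hausdorff _ K) cpi) => x xy.
    by apply: cq; rewrite qs xy.
  suff : nbhs y ((q \o s) @^-1` A) by [].
  by apply: nbhs_subset near_y => y' /(_ _ (sP y')).
- apply/seteqP; split => // z _.
  have : range q z by rewrite q_onto.
  by move=> [x _ <-]; exists (pi x) => //=; rewrite -qs.
- move=> k y /=; rewrite -qE; apply: (equicontinuous_factor_fiber eqZ fq).
  by rewrite semicocycle_factor_sigma !sP.
Qed.

(** * Toeplitz points of the orbit closure *)

Hypothesis disconnectedK : totally_disconnected [set: K].

Lemma finite_index_preimage N : open_normal N ->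
  finite_index_subgroup [set k : G | N (phi k)].
Proof.
move=> oN; split.
  split=> [|x y Nx Ny|x Nx] /=.
  - by rewrite multiplicative1; exact: open_normal1.
  - by rewrite gmulfM; exact: open_normalM.
  - by rewrite multiplicativeV; exact: open_normalV.
have [s cov] := finite_cosets oN compactK.
apply: sub_finite_set (finite_image (fun r => [set k : G | N (phi k * r^-1)])
  (finite_seq s)) => _ [k _ <-].
have [r rs Nr] := cov (phi k); exists r => //.
apply/seteqP; split => [h /= Nh|_ [h /= Nh <-]]; last first.
  by rewrite gmulfM -mulgA; exact: open_normalM.
exists (h * k^-1); last by rewrite mulgVK.
rewrite /= gmulfM multiplicativeV.
exact: open_normal_trans Nh (open_normal_sym oN Nr).
Qed.

(** The open colour class of [y^-1 * phi h] contains its coset under some open normal subgroup,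
    whose preimage in [G] is a period at [h]. *)
Lemma never_undecided_toeplitz x : never_undecided (pi x) ->
  toeplitz_array (val x).
Proof.
move=> ny h; set y := pi x; set u := y^-1 * phi h.
have stable (U : set K) : open U -> U u ->
    exists2 H : set G, finite_index_subgroup H &
      forall k, H k -> U (y^-1 * phi (k * h)).
  move=> oU Uu; have : nbhs (1 : K) ((fun t => t * u) @^-1` U).
    by apply: mulgr_continuous; rewrite mul1g; apply: open_nbhs_nbhs; split.
  move=> /(open_normal_basis compactK disconnectedK)[N oN NU].
  exists [set k | N (phi k)]; first exact: finite_index_preimage.
  move=> k /(open_normalJV oN y)/NU /=.
  by rewrite /u gmulfM !mulgA mulgK.
case: (ny h) => Uh.
  have [H fH HU] := stable _ openU1 Uh; exists H => //; exists true => // k Hk.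
  exact: (semicocycle_factorP x (k * h)).1 (HU _ Hk).
have [H fH HU] := stable _ openU0 Uh; exists H => //; exists false => // k Hk.
exact: negbTE ((semicocycle_factorP x (k * h)).2 (HU _ Hk)).
Qed.

(* The closure of [phi H] is a closed subgroup of finite index, hence open. *)
Lemma finite_index_dense (H : set G) : finite_index_subgroup H ->
  exists2 A : set K, open A /\ A 1 &
    forall U : set K, open U -> (U `&` A) !=set0 -> exists2 k, H k & U (phi k).
Proof.
move=> [[H1 HM HV] finH].
pose coset k := [set h * k | h in H].
pose far := [set C | range coset C /\ ~ closure (phi @` C) (1 : K)].
pose A := ~` \bigcup_(C in far) closure (phi @` C).
have oA : open A.
  apply: closed_openC; apply: closed_bigcup => [|C _]; last exact: closed_closure.
  by apply: sub_finite_set finH => C [].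
exists A; first by split => // -[C [_ nC]].
move=> U oU [u [Uu Au]].
have [k [Uk Ak]] := dense_phi (openI oU oA) (ex_intro _ u (conj Uu Au)).
(* Since [phi k] is in [A], the closure of [phi (H k)] contains [1]. So some [phi (h * k)] with [h]
   in [H] is near [1], and [phi h^-1] is near [phi k], hence in [U]. *)
have Ck1 : closure (phi @` coset k) (1 : K).
  apply: contrapT => nC; apply: Ak; exists (coset k); first by split => //; exists k.
  by apply: subset_closure; exists k => //; exists 1; rewrite ?mul1g.
have nU : nbhs (1 : K) [set z | U (phi k * z^-1)].
  have cv : (fun z => phi k * z^-1) @ (1 : K) --> phi k * 1^-1.
    by apply: cvg_mulg; [exact: cvg_cst|exact: invg_continuous].
  by apply: cv; rewrite invg1 mulg1; apply: open_nbhs_nbhs; split.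
have [_ [[_ [h Hh <-] <-]]] := Ck1 _ nU.
rewrite /= -multiplicativeV -gmulfM invgM mulgA mulgV mul1g => Uh.
by exists h^-1 => //; exact: HV.
Qed.

(** Near an undecided point [(pi x)^-1 * phi h] both colours occur, and by [finite_index_dense] they
    occur at coordinates [k * h] with [k] in [H]; so [x] is not constant there. *)
Lemma toeplitz_never_undecided x : toeplitz_array (val x) ->
  never_undecided (pi x).
Proof.
move=> tx h; apply: contrapT => /not_orP[n1 n0].
have [H fH [a _ Ha]] := tx h.
have [A [oA A1] HA] := finite_index_dense fH.
have meets (U : set K) : open U -> (forall B, nbhs ((pi x)^-1 * phi h) B ->
    (U `&` B) !=set0) -> exists2 k, H k & U ((pi x)^-1 * phi (k * h)).
  move=> oU Ud.
  have /Ud[u [Uu Bu]] : nbhs ((pi x)^-1 * phi h)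
      [set u | A (pi x * u * (phi h)^-1)].
    have cv : (fun u => pi x * u * (phi h)^-1) @ ((pi x)^-1 * phi h) -->
        pi x * ((pi x)^-1 * phi h) * (phi h)^-1.
      by apply: cvg_mulg; [exact: mulgl_continuous|exact: cvg_cst].
    by apply: cv; rewrite mulVKg mulgV; apply: open_nbhs_nbhs; split.
  have [||k Hk Uk] := HA [set w | U ((pi x)^-1 * (w * phi h))].
  - apply: (@open_comp _ _ (fun w => w * phi h) [set z | U ((pi x)^-1 * z)]).
      by move=> z _; exact: mulgr_continuous.
    exact: open_mulgl.
  - by exists (pi x * u * (phi h)^-1); split => //=; rewrite mulgVK mulKg.
  by exists k => //; rewrite gmulfM.
have [k Hk] := meets _ openU1 (fun B => boundary1 n1 n0).
move=> /(semicocycle_factorP x (k * h)).1 xk; rewrite Ha// in xk.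
have [k' Hk'] := meets _ openU0 (fun B => boundary0 n1 n0).
by move=> /(semicocycle_factorP x (k' * h)).2; rewrite Ha// xk.
Qed.

(** * Irregularity *)

Variables (g : nat -> G) (D : nat -> set K).
Hypotheses (g_surj : forall k, exists n, g n = k) (g_inj : injective g)
  (clopenD : forall n, open (D n) /\ closed (D n))
  (decrD : forall m n, (m <= n)%N -> D n `<=` D m)
  (limitD : forall x, (~ U1 x /\ ~ U0 x) <-> forall n, D n x)
  (haarD : forall nu : probability (borel K) R, haar_measure nu ->
     forall (c : K) n, (2^-1 <= prob nu [set z | D n (c * z^-1)%g])%R)
  (sparse : forall n (z : K) i j, (i <= n)%N -> (j <= n)%N ->
     U1 (z * phi (g i)) -> D n (z * phi (g i)) ->
     U1 (z * phi (g j)) -> D n (z * phi (g j)) -> g i = g j).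

(** Both sides are continuous and agree on the dense orbit of the base point. *)
Lemma factor_map_semicocycle (p : X -> K) :
  factor_map (@sigma G eta) (translation phi) p ->
  forall x, p x = pi x * p (orbit_base eta).
Proof.
move=> [cp _ pE] x; set c := p (orbit_base eta).
apply: (metricGroup_hausdorff (K := K)) => A B Ap Bpi.
have nA : nbhs x (p @^-1` A) by exact: cp.
have nB : nbhs x (((fun y => y * c) \o pi) @^-1` B).
  have cv : continuous ((fun y => y * c) \o pi).
    move=> z; apply: continuous_comp; last exact: mulgr_continuous.
    exact: semicocycle_factor_continuous.
  exact: (cv x _ Bpi).
have := @filterI _ _ (nbhs_filter x) _ _ nA nB.
rewrite nbhsE => -[W [oW Wx] WAB].
have [k /WAB[/= Ak Bk]] := sigma_orbit_dense oW (ex_intro _ x Wx).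
exists (p (sigma k (orbit_base eta))); split => //.
rewrite semicocycle_factor_sigma semicocycle_factor_base mulg1 in Bk.
by rewrite pE.
Qed.

Lemma semicocycle_toeplitz : toeplitz_array eta.
Proof.
apply: (never_undecided_toeplitz (x := orbit_base eta)).
rewrite semicocycle_factor_base; exact: never_undecided1.
Qed.

(** Regularity allows any factor map [p], which is [pi] times a constant [c]. The sets [B n]
    decrease to a set of measure at least [1 / 2] containing no image of a Toeplitz point. *)
Lemma semicocycle_irregular : ~ regular_toeplitz phi eta.
Proof.
move=> [p [nu [[_ fp _] haar nu1]]].
set c := p (orbit_base eta).
have pE := factor_map_semicocycle fp.
pose T := [set z | never_undecided (z * c^-1)].
have TE : p @` @toeplitz_points G eta = T.
  have [_ pi_onto _] := semicocycle_factor_map.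
  apply/seteqP; split=> [_ [x Tx <-]|z Tz]; rewrite /T /=.
    by rewrite pE mulgK; exact: toeplitz_never_undecided.
  have [x _ xz] : range pi (z * c^-1) by rewrite pi_onto.
  exists x; last by rewrite pE xz mulgVK.
  by apply: never_undecided_toeplitz; rewrite xz.
have cont_h h : continuous (fun z : K => (z * c^-1)^-1 * phi h).
  move=> z; apply: cvg_mulg; last exact: cvg_cst.
  apply: (@cvg_comp _ _ _ (fun z => z * c^-1) (fun z => z^-1)).
    exact: mulgr_continuous.
  exact: invg_continuous.
have mT : measurable (T : set (borel K)).
  have -> : T = \bigcap_n [set z | (U1 `|` U0) ((z * c^-1)^-1 * phi (g n))].
    apply/seteqP; split=> [z Tz n _|z Tz h]; first exact: Tz.
    by have [n <-] := g_surj h; exact: Tz n I.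
  apply: bigcapT_measurable => n; apply: open_borel.
  by apply: (open_comp (fun z _ => cont_h (g n) z)); exact: openU.
pose B n := [set z | D n (c * z^-1)] : set (borel K).
have mB n : measurable (B n) by apply: borel_divl; case: (clopenD n).
have mBoo : measurable (\bigcap_n B n) by exact: bigcapT_measurable.
have half : (2^-1 <= prob nu (\bigcap_n B n))%R.
  rewrite -lee_fin -probE//.
  have cvgB : nu \o B @ \oo --> nu (\bigcap_n B n).
    apply: nonincreasing_cvg_mu => //.
      exact: le_lt_trans (probability_le1 nu (mB 0)) (ltry 1).
    by move=> m n mn; apply/subsetPset => z; exact: decrD.
  rewrite -(cvg_lim (@ereal_hausdorff R) cvgB).
  apply: lime_ge; first by apply/cvg_ex; exists (nu (\bigcap_n B n)).
  by apply: nearW => n; rewrite /= (probE nu (mB n)) lee_fin; exact: haarD.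
have disj : T `&` \bigcap_n B n = set0.
  apply/seteqP; split => // z [Tz Bz].
  have [n1 n0] := (limitD (c * z^-1)).2 (fun n => Bz n I).
  (* The condition already fails at the coordinate [1], since [c * z^-1] is in neither colour
     class. *)
  by have := Tz 1; rewrite multiplicative1 mulg1 invgM invgK => -[].
have := prob_le nu (measurableU _ _ mT mBoo) measurableT (@subsetT _ _).
rewrite prob_setT probU//.
have -> : prob nu T = 1%R by rewrite /prob -TE nu1.
by move: half; lra.
Qed.

(** * Measure conjugacy for an arbitrary invariant measure *)

Section MeasureConjugacy.
Variable mu : probability (borel X) R.
Hypothesis mu_inv : invariant_measure (@sigma G eta) mu.

Definition undecided_ones n : set X :=
  [set x : X | val x 1 /\ D n (pi x)^-1].

Lemma undecided_ones_clopen n :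
  open (undecided_ones n) /\ closed (undecided_ones n).
Proof.
have cpiV : continuous ((fun z : K => z^-1) \o pi).
  move=> x; apply: continuous_comp; first exact: semicocycle_factor_continuous.
  exact: invg_continuous.
have -> : undecided_ones n =
    (val : X -> array G) @^-1` [set x : array G | x 1] `&`
    ((fun z : K => z^-1) \o pi) @^-1` D n by apply/seteqP; split.
have [oD cD] := clopenD n.
have [op1 cl1] := array_coord_clopen (1 : G).
split.
  by apply: openI; apply: open_comp => // x _; exact: val_continuous.
by apply: closedI; apply: closed_comp => // x _; exact: val_continuous.
Qed.

(* Distinct translates by [g 0 .. g n] of the set are disjoint, so invariance
   alone bounds its measure by [1 / (n + 1)]. *)
Lemma undecided_ones_small n : (n.+1%:R * prob mu (undecided_ones n) <= 1)%R.
Proof.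
have [oW _] := undecided_ones_clopen n.
pose F i : set X :=
  if (i <= n)%N then sigma (g i)^-1 @^-1` undecided_ones n else set0.
have oF i : open (F i).
  rewrite /F; case: ifP => _; last exact: open0.
  by apply: open_comp => // x _; have [_ _ cs] := sigma_action eta; exact: cs.
have mF i : measurable (F i : set (borel X)) by exact: open_borel.
have FP i k : F i (sigma k (orbit_base eta)) -> (i <= n)%N /\
    U1 ((phi k)^-1 * phi (g i)) /\ D n ((phi k)^-1 * phi (g i)).
  rewrite /F; case: ifP => // in_ [x1 Dk]; split => //; split; last first.
    move: Dk; rewrite !semicocycle_factor_sigma semicocycle_factor_base mulg1.
    by rewrite invgM multiplicativeV invgK.
  move: x1; rewrite /= /array_shift /semicocycle_array invgK mulg1.
  by move=> /asboolP; rewrite mulVphi.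
have trivF : trivIset setT F.
  move=> i j _ _ [x Fx].
  (* The sets are open, so an intersection point can be taken on the orbit of the base point. There
     a coordinate equal to [1] really means membership in [U1], as [sparse] requires. *)
  have [k [Fi Fj]] := sigma_orbit_dense (openI (oF i) (oF j)) (ex_intro _ x Fx).
  have [in_ [Ui Di]] := FP _ _ Fi; have [jn [Uj Dj]] := FP _ _ Fj.
  by apply: g_inj; exact: sparse in_ jn Ui Di Uj Dj.
have := measure_bigsetU mu mF trivF n.+1.
rewrite (eq_bigr (fun=> (prob mu (undecided_ones n))%:E)) => [|i _]; last first.
  rewrite -(probE mu (open_borel oW)) /F -ltnS ltn_ord.
  by apply: mu_inv; exact: open_borel.
rewrite sumEFin sumr_const card_ord => muF.
have mB : measurable (\big[setU/set0]_(i < n.+1) F i : set (borel X)).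
  by apply: bigsetU_measurable.
by rewrite mulr_natl -lee_fin -muF; exact: probability_le1.
Qed.

Definition limit_ones_set : set X := [set x : X | val x 1 /\ ~ U1 (pi x)^-1].

(** At coordinate [1] the class [U0] would force the value [0], so a [1] not forced by [U1] sits at
    an undecided point. *)
Lemma limit_ones_setE : limit_ones_set = \bigcap_n undecided_ones n.
Proof.
apply/seteqP; split=> [x [x1 n1] n _|x x1].
  split => //; apply: ((limitD _).1 _ n); split => // U0x.
  have := (semicocycle_factorP x 1).2; rewrite multiplicative1 mulg1.
  by move=> /(_ U0x); rewrite x1.
split; first by case: (x1 0 I).
by have [] := (limitD (pi x)^-1).2 (fun n => (x1 n I).2).
Qed.

Lemma closed_limit_ones_set : closed limit_ones_set.
Proof.
rewrite limit_ones_setE; apply: closed_bigI => m _.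
by case: (undecided_ones_clopen m).
Qed.

Lemma limit_ones_null : mu.-negligible (limit_ones_set : set (borel X)).
Proof.
have mW n : measurable (undecided_ones n : set (borel X)).
  by apply: open_borel; case: (undecided_ones_clopen n).
have mL := closed_borel closed_limit_ones_set.
exists limit_ones_set; split => //.
rewrite (probE mu mL); congr EFin; apply/eqP; rewrite eq_le prob_ge0 andbT.
rewrite leNgt; apply/negP => pos.
have [n _ /(_ n (leqnn n)) /= nlt] := near_infty_natSinv_lt (PosNum pos).
have : (prob mu limit_ones_set <= prob mu (undecided_ones n))%R.
  by apply: prob_le => //; rewrite limit_ones_setE => x; apply.
have := undecided_ones_small n; rewrite mulrC -ler_pdivlMr ?ltr0n// mul1r.
by move=> le1 le2; have := lt_le_trans nlt (le_trans le2 le1); rewrite ltxx.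
Qed.

(** Compatibility already gives [0] on [U0], so the condition bears on undecided coordinates only;
    it makes the point a function of its image under [pi]. *)
Definition generic_points : set X :=
  [set x : X | forall h, ~ U1 ((pi x)^-1 * phi h) -> ~~ val x h].

Definition standard_array (y : K) : array G := fun h => `[< U1 (y^-1 * phi h) >].

(** This is the image of [generic_points], see [generic_bij], written as the preimage of a closed
    set under [standard_array] so that it is Borel. *)
Definition realized : set K := [set y | orbit_closure eta (standard_array y)].

Lemma generic_standard x : generic_points x -> val x = standard_array (pi x).
Proof.
move=> gx; apply/funext => h; rewrite /standard_array.
case: asboolP => [U1h|/gx/negbTE//]; exact: (semicocycle_factorP x h).1.
Qed.

Lemma standard_compatible y : compatible (standard_array y) y.
Proof.
move=> h; split=> [U1h|U0h]; first exact/asboolP.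
by apply/negP => /asboolP/disjoint01; apply.
Qed.

Lemma realized_generic y : realized y ->
  exists x, [/\ generic_points x, pi x = y & val x = standard_array y].
Proof.
move=> ry; pose x : X := exist (fun z => z \in orbit_closure eta) _ (mem_set ry).
have xy : pi x = y by apply: semicocycle_factor_eq; exact: standard_compatible.
by exists x; split => // h; rewrite xy /= => nU1; apply/negP => /asboolP.
Qed.

Lemma generic_bij : set_bij generic_points realized pi.
Proof.
split.
- move=> x gx; rewrite /realized /= -generic_standard//.
  exact: set_mem (valP x).
- move=> x x' /set_mem gx /set_mem gx' xx'; apply: val_inj.
  by rewrite !generic_standard// xx'.
- by move=> y /realized_generic[x [gx xy _]]; exists x.
Qed.

Lemma generic_sigma k x : generic_points x -> generic_points (sigma k x).
Proof.
move=> gx h; rewrite semicocycle_factor_sigma invgM -mulgA mulVphi.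
exact: gx.
Qed.

Lemma invariant_subset (S : Type) (act : G -> S -> S) (A : set S) :
  (forall x, act 1 x = x) -> (forall k h x, act (k * h) x = act k (act h x)) ->
  (forall k x, A x -> A (act k x)) -> invariant_set act A.
Proof.
move=> act1 actM inv k; apply/seteqP; split=> [_ [x Ax <-]|x Ax]; first exact: inv.
by exists (act k^-1 x); [exact: inv|rewrite -actM mulgV act1].
Qed.

Lemma generic_invariant : invariant_set (@sigma G eta) generic_points.
Proof.
have [act1 actM _] := sigma_action eta.
by apply: invariant_subset => // k x; exact: generic_sigma.
Qed.

Lemma realized_invariant : invariant_set (translation phi) realized.
Proof.
have [_ [act1 actM _] _] := translation_equicontinuous phi compactK.
apply: invariant_subset => // k y ry; rewrite /realized /=.
have -> : standard_array (translation phi k y) = array_shift k (standard_array y).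
  apply/funext => h; rewrite /standard_array /array_shift /translation.
  by rewrite invgM -mulgA mulVphi.
exact: orbit_closure_shift.
Qed.

(** A bad coordinate [h] is shifted to [1]; countability of [G] then makes the complement a
    countable union of null sets. *)
Lemma genericC :
  ~` generic_points = \bigcup_n sigma (g n)^-1 @^-1` limit_ones_set.
Proof.
apply/seteqP; split=> [x|x [n _ [/= + nU1] gx]].
  move=> /existsNP[h /not_implyP[nU1 /negP]]; rewrite negbK => xh.
  have [n gn] := g_surj h; exists n => //; split => /=.
    by rewrite /array_shift gn invgK mulg1.
  by rewrite semicocycle_factor_sigma gn invgM multiplicativeV invgK.
move: nU1; rewrite semicocycle_factor_sigma invgM multiplicativeV invgK.
by move=> /gx xn; rewrite /array_shift invgK mulg1 (negbTE xn).
Qed.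

Lemma measurable_limit_ones_shift n :
  measurable (sigma (g n)^-1 @^-1` limit_ones_set : set (borel X)).
Proof.
apply: closed_borel; apply: closed_comp => [x _|].
  by have [_ _ cs] := sigma_action eta; exact: cs.
exact: closed_limit_ones_set.
Qed.

Lemma measurable_generic : measurable (generic_points : set (borel X)).
Proof.
rewrite -(setCK generic_points) genericC; apply: measurableC.
by apply: bigcup_measurable => n _; exact: measurable_limit_ones_shift.
Qed.

Lemma genericC_null : mu (~` generic_points) = 0%E.
Proof.
apply: measure_negligible.
  by apply: measurableC; exact: measurable_generic.
rewrite genericC; apply: negligible_bigcup => n.
have mL := closed_borel closed_limit_ones_set.
exists (sigma (g n)^-1 @^-1` limit_ones_set); split => //.
  exact: measurable_limit_ones_shift.
apply: etrans (mu_inv (g n)^-1 mL) _; apply: measure_negligible => //.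
exact: limit_ones_null.
Qed.

(** An open set of arrays is a union of cylinders, indexed by the countable type [seq bool], and
    each coordinate of [standard_array] is the indicator of an open set. *)
Lemma measurable_standard (W : set (array G)) : open W ->
  measurable ([set y | W (standard_array y)] : set (borel K)).
Proof.
move=> oW; pose cyl (b : seq bool) : set (array G) :=
  [set x | forall i, (i < size b)%N -> x (g i) = nth false b i].
have -> : [set y | W (standard_array y)] = \bigcup_b
    [set y | cyl b `<=` W /\ cyl b (standard_array y)].
  apply/seteqP; split=> [y Wy|y [b _ [bW yb]]]; last exact: bW.
  have [n nW] := near_cylinder g_surj oW Wy.
  exists (mkseq (fun i => standard_array y (g i)) n) => //; split; last first.
    by move=> i; rewrite size_mkseq => lt_in; rewrite nth_mkseq.
  move=> x bx; apply: nW => i lt_in.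
  by rewrite bx ?size_mkseq// nth_mkseq.
apply: countable_bigcupT_measurable; first exact: countableP.
move=> b; have [bW|nbW] := pselect (cyl b `<=` W); last first.
  by rewrite (_ : mkset _ = set0)//; apply/seteqP; split => // y [].
have -> : [set y | cyl b `<=` W /\ cyl b (standard_array y)] =
    \bigcap_i [set y | (i < size b)%N -> standard_array y (g i) = nth false b i].
  apply/seteqP; split=> [y [_ yb] i _|y yb]; first exact: yb.
  by split => // i; exact: (yb i I).
apply: bigcapT_measurable => i.
have mU : measurable ([set y | U1 (y^-1 * phi (g i))] : set (borel K)).
  apply: open_borel; apply: (@open_comp _ _ (fun y => y^-1 * phi (g i))) => //.
  move=> y _; apply: cvg_mulg; last exact: cvg_cst.
  exact: (@invg_continuous _ K y).
case: (ltnP i (size b)) => [_|ib]; last first.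
  by rewrite (_ : mkset _ = setT)//; apply/seteqP; split.
case: (nth false b i).
  rewrite (_ : mkset _ = [set y | U1 (y^-1 * phi (g i))])//.
  by apply/seteqP; split=> [y /(_ isT)/asboolP//|y Uy _]; exact/asboolP.
rewrite (_ : mkset _ = ~` [set y | U1 (y^-1 * phi (g i))]); last first.
  apply/seteqP; split=> [y /(_ isT) /= /negbT/asboolPn//|y nUy _].
  by apply/negbTE/asboolPn.
exact: measurableC.
Qed.

Lemma measurable_realized : measurable (realized : set (borel K)).
Proof.
rewrite -(setCK realized); apply: measurableC.
by apply: (measurable_standard (closed_openC (@orbit_closure_closed _ eta))).
Qed.

(** The inverse of [pi] on [realized], made total by the value [orbit_base eta] elsewhere. *)
Definition standard_point (y : K) : X :=
  if pselect (realized y) is left ry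
  then exist (fun z => z \in orbit_closure eta) _ (mem_set ry)
  else orbit_base eta.

Lemma val_standard_point y : realized y ->
  val (standard_point y) = standard_array y.
Proof. by rewrite /standard_point; case: pselect. Qed.

Lemma measurable_standard_point :
  measurable_fun setT (standard_point : borel K -> borel X).
Proof.
apply: (@measurability _ _ (borel K) (borel X) _ standard_point (@open X)) => //.
move=> _ [_ [W oW <-] <-]; rewrite setTI.
have mW := measurable_standard oW.
have -> : standard_point @^-1` (set_val @^-1` W) =
    (realized `&` [set y | W (standard_array y)]) `|`
    (~` realized `&` [set _ | W eta]).
  apply/seteqP; split=> [y /=|y [[ry Wy]|[nry We]]] /=.
  - rewrite /standard_point; case: pselect => [ry|nry] /= Wy.
      by left; split.
    by right; split.
  - by have := val_standard_point ry; rewrite /set_val /= => ->.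
  - by rewrite /standard_point; case: pselect.
have mR := measurable_realized.
apply: measurableU; first exact: measurableI.
apply: measurableI; first exact: measurableC.
have [We|nWe] := pselect (W eta).
  by rewrite (_ : mkset _ = setT)//; apply/seteqP; split.
by rewrite (_ : mkset _ = set0)//; apply/seteqP; split.
Qed.

Lemma semicocycle_measure_conjugacy :
  measure_conjugacy (@sigma G eta) (translation phi) pi mu.
Proof.
have mpi : measurable_fun setT (pi : borel X -> borel K).
  exact: continuous_borel semicocycle_factor_continuous.
exists generic_points, realized; split.
- split; [exact: measurable_generic|exact: generic_invariant|exact: genericC_null].
- split; [exact: measurable_realized|exact: realized_invariant|].
  change (mu (pi @^-1` (~` realized)) = 0%E); apply: measure_negligible.
    rewrite -[X in measurable X]setTI.
    by apply: mpi => //; apply: measurableC; exact: measurable_realized.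
  exists (~` generic_points); split; last 1 first.
  + move=> x nrx gx; apply: nrx.
    by have [fun_pi _ _] := generic_bij; exact: fun_pi.
  + by apply: measurableC; exact: measurable_generic.
  + exact: genericC_null.
- exact: generic_bij.
- exact: measurable_funTS.
move=> A mA AX'.
(* Images under [pi] of subsets of [generic_points] become preimages under the measurable map
   [standard_point]. *)
have -> : pi @` A = realized `&` (setT `&` standard_point @^-1` A).
  have [fun_pi _ _] := generic_bij.
  apply/seteqP; split=> [_ [x Ax <-]|y [ry [_ Ay]]].
    have gx := AX' _ Ax; have ry := fun_pi _ gx; split => //; split => //=.
    suff -> : standard_point (pi x) = x by [].
    by apply: val_inj; rewrite val_standard_point// -generic_standard.
  exists (standard_point y) => //; apply: semicocycle_factor_eq.
  by rewrite val_standard_point//; exact: standard_compatible.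
apply: measurableI; first exact: measurable_realized.
exact: measurable_standard_point.
Qed.

End MeasureConjugacy.

Lemma semicocycle_topo_isomorphic :
  topo_isomorphic_extension R (@sigma G eta) (translation phi).
Proof.
exists pi; first exact: semicocycle_factor_map.
by move=> mu mu_inv; exact: semicocycle_measure_conjugacy.
Qed.

End Semicocycle.

(** * Enumeration of [G] and conclusion *)

Lemma countable_infinite_enum (T : Type) :
  countable [set: T] -> infinite_set [set: T] ->
  exists2 g : nat -> T, injective g & forall x, exists n, g n = x.
Proof.
move=> cT iT.
have : ([set: T] #= [set: nat])%card.
  by rewrite card_eq_le; apply/andP; split; [exact: cT|exact/infiniteP].
move=> /card_set_bijP[f [_ f_inj f_surj]].
have /choice[g fg] : forall n, exists x, f x = n.
  by move=> n; have [x _ fx] := f_surj n I; exists x.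
exists g; first exact: can_inj fg.
by move=> x; exists (f x); apply: f_inj; rewrite ?inE.
Qed.

Theorem theorem1p1 (R : realType) (G : groupType)
    (G_countable : countable [set: G]%classic)
    (G_infinite : infinite_set [set: G]%classic)
    (G_resfin : residually_finite G)
    (K : metricGroupType R) (iota : {multiplicative G -> K})
    (iotaP : td_metric_compactification iota) :
  exists eta : array G,
    [/\ irregular_toeplitz iota eta,
        exists pi : orbit_closure_space eta -> K,
          maximal_equicontinuous_factor (@sigma G eta) (translation iota) pi &
        topo_isomorphic_extension R (@sigma G eta) (translation iota)].
Proof.
have [cK tdK iota_inj iota_dense] := iotaP.
have [g g_inj g_surj] := countable_infinite_enum G_countable G_infinite.
have [T] := towerP g cK tdK G_infinite iota_inj.
(* Every pair of naturals is reached; numbers that code no pair are sent to [(0, 0)]. *)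
pose decode k : nat * nat := odflt (0, 0) (unpickle k).
have decode_surj p : exists k, decode k = p.
  by exists (pickle p); rewrite /decode pickleK.
pose U1 := ones T decode; pose U0 := zeros T decode.
have [openU1 openU0] : open U1 /\ open U0 := ones_zeros_open T decode.
have disjoint01 x : U1 x -> ~ U0 x by move=> U1x; apply; left.
have boundary x : (~ U1 x /\ ~ U0 x) <-> forall n, undecided T decode n x.
  split=> [[n1 n0] n|Dx].
    have : limit_undecided T decode x.
      by apply: contrapT => nD; apply: n0 => -[].
    exact.
  have Lx : limit_undecided T decode x by move=> n _; exact: Dx.
  by split=> [/ones_limit/(_ Lx)//|]; apply; right.
have limit n1 n0 := (boundary _).1 (conj n1 n0).
have colored k : U1 (iota k) \/ U0 (iota k).
  have [|n1] := pselect (U1 (iota k)); [by left|right].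
  by move=> [//|]; exact: phi_decided.
have aperiodic := @ones_aperiodic _ _ _ _ _ T decode.
have boundary1 d A : ~ U1 d -> ~ U0 d -> nbhs d A -> (U1 `&` A) !=set0.
  by move=> n1 n0; apply: limit_ones => // n _; exact: limit.
have boundary0 d A : ~ U1 d -> ~ U0 d -> nbhs d A -> (U0 `&` A) !=set0.
  by move=> n1 n0; apply: limit_zeros => // n _; exact: limit.
exists (semicocycle_array iota U1); split.
- split.
    exact: (semicocycle_toeplitz cK iota_dense openU1 openU0 disjoint01 colored
      aperiodic tdK).
  apply: (semicocycle_irregular cK iota_dense openU1 openU0 disjoint01
    aperiodic boundary1 boundary0 tdK g_surj (undecided_clopen T decode) _
    boundary).
    by move=> m n; exact: undecided_sub.
  by move=> nu haar c n; exact: haar_undecided.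
- eexists; exact: (semicocycle_maximal cK iota_dense openU1 openU0 disjoint01
    colored aperiodic).
- apply: (semicocycle_topo_isomorphic cK iota_dense openU1 openU0 disjoint01
    aperiodic g_surj g_inj (undecided_clopen T decode) boundary).
  exact: ones_sparse.
Qed.
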